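(* Let $K\subset S^3$ be an oriented knot with generic planar diagram $D_K$, let $\pi=\pi_1(S^3-K)$, let $R$ be an integral domain, and let $\rho:\pi\to GL_n(R)$ be a representation. Choose two adjacent faces of $D_K$ to disregard, one of which is the unbounded face. Perform the twisted dimer construction: 1. build the twisted Alexander graph $\Gamma'$ with its weight function $\alpha_\rho$; 2. choose an embedding (drawing in the plane) of $\Gamma'$ that minimizes the number of edge crossings; 3. triple any edges necessary so that each pair of edges intersects at most once, updating the weight function; call the new graph $\Gamma''$ and the new weight function $\alpha_{\rho,t}$; 4. replace any crossing pairs of edges with butterflies, updating the weight function; call the resulting graph $\Gamma'''$ and the new weight function $\alpha_{\rho,b}$; 5. use the spanning tree algorithm to get a Kasteleyn weighting $\epsilon$ for $\Gamma'''$; 6. calculate the partition function $$Z(\Gamma'''_{\epsilon\cdot\alpha_{\rho,b}})=\sum_{m\in\mathcal M}\Big(\prod_{e\in m}\epsilon(e)\cdot\alpha_{\rho,b}(e)\Big),$$ where $\mathcal M$ is the set of dimer coverings of $\Gamma'''$. Then this calculates the twisted Alexander polynomial of the pair $K,\rho$: $$Z(\Gamma'''_{\epsilon\cdot\alpha_{\rho,b}})\ \doteq\ \Delta_{K,\rho}(t).$$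
   Context: **Notation.** $\doteq$ means equality up to multiplication by $\pm t^k$ for some integer $k$. A dimer covering of a bipartite graph $(V_1,V_2,E)$ is a perfect matching, i.e. a set $m\subseteq E$ such that each vertex is an endpoint of exactly one edge of $m$. **Kasteleyn weighting.** For a bipartite plane graph with edge set $E$, a Kasteleyn weighting is a map $\epsilon:E\to\{\pm1\}$ such that each bounded face with $0$ mod $4$ edges has an odd number of $-1$ assignments and each bounded face with $2$ mod $4$ edges has an even number of $-1$ assignments. Spanning tree algorithm: choose a spanning tree $T$ of the graph and assign signs to its edges arbitrarily; the edges of the dual plane graph transverse to the edges not in $T$ form a spanning tree $\bar T$ of the dual graph, rooted at the unbounded face. Repeatedly take a non-root valence 1 vertex of $\bar T$; it represents a face all but one of whose edges already have a sign, so the sign of the remaining edge is forced by the Kasteleyn condition; assign it, and prune this vertex and its edge from $\bar T$. Continue until all edges have signs. **Local convention at a crossing.** Rotate a crossing so that the overstrand runs, in the direction of its orientation, from south-west to north-east. Let $a_1,a_2,a_3,a_4$ be the faces at the North, West, East, South respectively (North and West are to the left of the overstrand, East and South to the right). **Dehn presentation and twisted Alexander polynomial.** Let $a_0,\dots,a_m$ be the faces of $D_K$, $a_0$ unbounded. With base point above the plane of projection, let $A_i\in\pi$ be the loop passing through $a_i$ and returning through $a_0$ to the base point; so $A_0=1$. Each crossing gives a relation $A_4A_2^{-1}=A_3A_1^{-1}$ (indices as in the local convention), i.e. the relator $r=A_4A_2^{-1}A_1A_3^{-1}$; setting $A_0=1$ gives $\pi=\langle A_1,\dots,A_m\mid r_1,\dots,r_{m-1}\rangle$.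 The Wirtinger generator of an arc of the diagram is the meridian positively linking that arc; that of the overstrand above is $A_4A_2^{-1}$. Let $\mathcal F_m$ be the free group on $A_1,\dots,A_m$, $\phi:\mathbb Z[\mathcal F_m]\to\mathbb Z[\pi]$ the canonical map, $\psi:\mathbb Z[\pi]\to\mathbb Z[t^{\pm1}]$ the abelianization sending meridians positively linking the knot to $t$, and $\Phi=(\rho\otimes\psi)\circ\phi:\mathbb Z[\mathcal F_m]\to M_n(R[t^{\pm1}])$. Let $M_{K,\rho}$ be the $n(m-1)\times nm$ block matrix whose $ij$-th block is $\Phi(\partial r_i/\partial A_j)$ (Fox free derivatives), and let $M'_{K,\rho}$ be obtained by deleting a block column corresponding to a face adjacent to the unbounded face. The determinant of $M'_{K,\rho}$ is well defined up to sign and powers of $t$, and $\Delta_{K,\rho}(t)\doteq\det(M'_{K,\rho})$. **Twisted Alexander graph.** $\Gamma'=(V_1',V_2',E')$ is the bipartite graph in which $V_1'$ has $n$ (enumerated) vertices for each crossing and $V_2'$ has $n$ (enumerated) vertices for each face that is not disregarded. If a face and a crossing are incident, a copy of $K_{n,n}$ is inserted between the vertices of that face and those of that crossing; if they are not incident, there are no edges between them. The weighting $\alpha_\rho:E'\to R[t^{\pm1}]$ is such that this copy of $K_{n,n}$ encodes an $n\times n$ matrix $B$: the edge from the $i$-th crossing vertex to the $j$-th face vertex has weight $B_{ij}$, and is omitted if $B_{ij}=0$. Here $B=tX$ for the faces at the North and West of the crossing and $B=\mathrm{Id}$ for the faces at the East and South, where $X\in GL_n(R)$ is the image under $\rho$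 of the Wirtinger generator of the overstrand at the crossing. **Tripling.** An edge of weight $a$ between $v\in V_1$ and $y\in V_2$ is replaced by a path of three edges along the old edge, using a new vertex $u$ in the first vertex class and a new vertex $w$ in the second: $yu$ has weight $a$, $uw$ has weight $-1$, and $wv$ has weight $1$. **Butterfly.** Suppose an edge $p_1q_2$ of weight $a$ crosses an edge $p_2q_1$ of weight $b$, with $p_1,p_2$ in the first vertex class and $q_1,q_2$ in the second. Delete these two edges, add a new vertex $u$ to the first class and a new vertex $w$ to the second, and add the seven edges $uw$ (weight $-1$), $uq_1$ (weight $-1$), $uq_2$ (weight $a$), $p_1w$ (weight $1$), $p_1q_1$ (weight $1$), $p_2w$ (weight $-b$), $p_2q_2$ (weight $ab$), drawn without crossing each other.
   Formalization: The block column deleted for Δ is that of the disregarded face (another choice can change it by det ρ(meridian)); step 3 means each edge is crossed at most once; a face meeting a crossing twice gets one K_{n,n} per corner; disconnected graphs use spanning forests. *)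

(* Defs.v *)
From HB Require Import structures.
From mathcomp Require Import all_boot all_order all_algebra.
Set Implicit Arguments.
Unset Strict Implicit.
Unset Printing Implicit Defensive.
Import GRing.Theory.
Local Open Scope ring_scope.

(* Plane maps.  A dart is an oriented edge: [flip] reverses it, and [turn]
   sends it to the next dart counterclockwise with the same origin, so vertices
   are the orbits of [turn]. *)
Record plane_map := PlaneMap {
  dart :> finType;
  flip : dart -> dart;
  turn : dart -> dart }.
Arguments flip {p} _.
Arguments turn {p} _.

Section PlaneMaps.
Variable M : plane_map.
Implicit Types d : M.

(* At the end of [d], take the sharpest left turn: this walks along the
   boundary of the face to the left of [d]. *)
Definition walk d : M := finv turn (flip d).

(* Faces are identified with sets of darts, so an edge with the same face on
   both sides counts twice in the length of the boundary of that face. *)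
Definition left_face d : {set M} := [set d' | fconnect walk d d'].

Definition link : rel M := fun x y => (flip x == y) || (turn x == y).

(* The last equation is Euler's formula V - E + F = 2C in the form
   E + V + F = 2E + 2C; since F counts orbits of [walk], it says that every
   connected component is drawn on a sphere of its own. *)
Definition spherical : Prop :=
  [/\ involutive (@flip M), forall d, flip d != d, injective (@turn M) &
      fcard (@flip M) predT + fcard (@turn M) predT + fcard walk predT
        = #|M| + 2 * n_comp link predT]%N.

(* The opposite dart at a vertex of even degree. *)
Definition across d : M := iter (order turn d)./2 turn d.

End PlaneMaps.

(* Oriented knot diagrams: [forth d] says that [d] points along the orientation
   of the knot, [over d] that, at the crossing from which it issues, [d] lies
   on the overstrand.  Vertices of degree 4 are the crossings; vertices of
   degree 2 are marked points, which affect neither faces nor crossings, and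
   make it possible to represent the diagram without crossings. *)
Record knot_diagram := KnotDiagram {
  shadow :> plane_map;
  over : pred shadow;
  forth : pred shadow;
  shadow_spherical : spherical shadow;
  shadow_degree : forall d : shadow, order turn d \in [:: 2; 4]%N;
  over_turn : forall d : shadow,
    order turn d = 4%N -> over (turn d) = ~~ over d;
  forth_flip : forall d : shadow, forth (flip d) = ~~ forth d;
  forth_across : forall d : shadow, forth (across d) = ~~ forth d;
  one_component : forall d d' : shadow, forth d -> forth d' ->
    fconnect (fun x : shadow => across (flip x)) d d';
  shadow_nonempty : (0 < #|shadow|)%N }.

Section Diagrams.
Variable D : knot_diagram.

Definition face := {F : {set D} | F \in [set left_face d | d : D]}.

Definition lface (d : D) : face :=
  exist _ (left_face d) (imset_f (@left_face D) (isT : d \in D)).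

Definition adjacent (F F' : face) : Prop :=
  exists d : D, lface d = F /\ lface (flip d) = F'.

(* A crossing is represented by the outgoing dart of its overstrand. *)
Definition crossing :=
  {d : D | [&& order turn d == 4%N, over d & forth d]}.

(* The corner between [iter i turn c] and [iter i.+1 turn c].  As the dart [c]
   points north-east, i = 0, 1, 2, 3 are North, West, South, East. *)
Definition corner (c : crossing) (i : 'I_4) : face :=
  lface (iter i turn (val c)).

Definition north (c : crossing) : face := corner c (inord 0).
Definition west (c : crossing) : face := corner c (inord 1).
Definition south (c : crossing) : face := corner c (inord 2).
Definition east (c : crossing) : face := corner c (inord 3).

(* The Dehn presentation, [a0] being the unbounded face. *)
Variable a0 : face.

Definition gen := {F : face | F != a0}.

(* (g, true) stands for g and (g, false) for its inverse *)
Definition word := seq (gen * bool).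

Definition inv_word (w : word) : word := rev [seq (x.1, ~~ x.2) | x <- w].

Definition loop (F : face) : word :=
  if (insub F : option gen) is Some g then [:: (g, true)] else [::].

(* for a dart along the knot, its meridian: right-hand face, then back through
   the left-hand face *)
Definition wirtinger (d : D) : word :=
  loop (lface (flip d)) ++ inv_word (loop (lface d)).

Definition over_meridian (c : crossing) : word :=
  loop (south c) ++ inv_word (loop (west c)).

Definition relator (c : crossing) : word :=
  over_meridian c ++ loop (north c) ++ inv_word (loop (east c)).

(* The knot group is the set of words modulo this congruence. *)
Inductive group_eq : word -> word -> Prop :=
| group_refl u : group_eq u u
| group_sym u v : group_eq u v -> group_eq v u
| group_trans u v w : group_eq u v -> group_eq v w -> group_eq u w
| group_cat u u' v v' :
    group_eq u u' -> group_eq v v' -> group_eq (u ++ v) (u' ++ v')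
| group_cancel g b : group_eq [:: (g, b); (g, ~~ b)] [::]
| group_relator c : group_eq (relator c) [::].

Definition representation (R : comUnitRingType) (n : nat)
    (rho : word -> 'M[R]_n) : Prop :=
  [/\ forall u, rho u \in unitmx,
      rho [::] = 1%:M,
      forall u v, rho (u ++ v) = rho u *m rho v &
      forall u v, group_eq u v -> rho u = rho v].

(* psi gives the exponent of t *)
Definition abelianization (psi : word -> int) : Prop :=
  [/\ forall u v, psi (u ++ v) = psi u + psi v,
      forall u v, group_eq u v -> psi u = psi v &
      forall d : D, forth d -> psi (wirtinger d) = 1].

(* Elements of the group ring of the free group, as formal sums. *)
Definition free_ring := seq (int * word).

Fixpoint fox (g : gen) (w : word) : free_ring :=
  if w is x :: w' then
    (if x.1 == g then [:: if x.2 then (1, [::]) else (-1, [:: x])] else [::])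
      ++ [seq (s.1, x :: s.2) | s <- fox g w']
  else [::].

End Diagrams.

(* R[t, t^-1] is regarded as a subring of the field of fractions of R[t]. *)
Section Laurent.
Variable R : idomainType.

Definition laurent_t : {fraction {poly R}} := tofrac 'X.
Definition laurent_cst (r : R) : {fraction {poly R}} := tofrac r%:P.

Definition doteq (p q : {fraction {poly R}}) : Prop :=
  exists (b : bool) (k : int), p = (-1) ^+ b * laurent_t ^ k * q.

Variables (n : nat) (D : knot_diagram) (a0 : face D).
Variables (rho : word a0 -> 'M[R]_n) (psi : word a0 -> int).

Definition Phi (s : free_ring a0) : 'M[{fraction {poly R}}]_n :=
  \sum_(x <- s)
    x.1%:~R *: (laurent_t ^ psi x.2 *: map_mx laurent_cst (rho x.2)).

(* The determinant of M', the relators and generators being enumerated by [cr]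
   and [fc]; the block column of the generator [fc j0] is deleted. *)
Definition twisted_alexander (k : nat) (cr : 'I_k -> crossing D)
    (fc : 'I_k.+1 -> gen a0) (j0 : 'I_k.+1) : {fraction {poly R}} :=
  \det (\mxblock_(i < k, j < k) Phi (fox (fc (lift j0 j)) (relator a0 (cr i)))).

End Laurent.

Record bigraph (K : Type) := BiGraph {
  first_class : finType;
  second_class : finType;
  edge : finType;
  first_end : edge -> first_class;
  second_end : edge -> second_class;
  weight : edge -> K }.
Arguments first_end {K b} _.
Arguments second_end {K b} _.
Arguments weight {K b} _.

Section TwistedGraph.
Variables (R : idomainType) (n : nat) (D : knot_diagram) (a0 a1 : face D).
Variable rho : word a0 -> 'M[R]_n.

Definition kept_face := {F : face D | (F != a0) && (F != a1)}.

Definition corner_block (c : crossing D) (i : 'I_4) :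
    'M[{fraction {poly R}}]_n :=
  if (i < 2)%N
  then laurent_t R *: map_mx (@laurent_cst R) (rho (over_meridian a0 c))
  else 1%:M.

(* One copy of K_{n,n} for each corner at which the face meets the crossing:
   at a nugatory crossing the same face occupies two opposite corners. *)
Definition is_twisted_edge
    (x : crossing D * 'I_4 * kept_face * ('I_n * 'I_n)) : bool :=
  let: (c, i, F, (p, q)) := x in
  (corner c i == val F) && (corner_block c i p q != 0).

Definition twisted_edge := {x | is_twisted_edge x}.

Definition twisted_graph : bigraph {fraction {poly R}} :=
  @BiGraph {fraction {poly R}}
    (crossing D * 'I_n)%type (kept_face * 'I_n)%type twisted_edge
    (fun e => let: (c, i, F, (p, q)) := val e in (c, p))
    (fun e => let: (c, i, F, (p, q)) := val e in (F, q))
    (fun e => let: (c, i, F, (p, q)) := val e in corner_block c i p q).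

End TwistedGraph.

(* A drawing in the plane of a weighted bipartite graph, possibly with
   crossings, given by the plane map obtained by making every crossing point a
   vertex.  [org d] is the vertex of the graph from which the dart [d] issues,
   [None] if it issues from a crossing point.  Each edge of the graph has
   exactly one dart issuing from the first class; this dart stands for the
   edge, and [wt] is meaningful on such darts only.  [outer d] says that the
   unbounded face (of the component of d) is to the left of [d]. *)
Record drawing (K : Type) := Drawing {
  plan :> plane_map;
  fst_vertex : finType;
  snd_vertex : finType;
  org : plan -> option (fst_vertex + snd_vertex);
  wt : plan -> K;
  outer : pred plan }.
Arguments org {K d} _.
Arguments wt {K d} _.
Arguments outer {K d} _.

Section Drawings.
Variables (K : Type) (G : drawing K).
Implicit Types d : G.

Definition is_crossing d : bool := if org d is None then true else false.
Definition is_fst d : bool := if org d is Some (inl _) then true else false.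
Definition is_snd d : bool := if org d is Some (inr _) then true else false.

(* [on_strand d d']: d' is reached from d by following an edge of the graph,
   straight on through the crossing points *)
Inductive on_strand d : G -> Prop :=
| strand_start : on_strand d d
| strand_ahead d' : on_strand d d' -> is_crossing (flip d') ->
    on_strand d (turn (turn (flip d'))).

Definition well_drawn : Prop :=
  [/\ spherical G,
      forall d d', fconnect turn d d' -> org d = org d',
      forall d d', ~~ is_crossing d -> org d = org d' -> fconnect turn d d' &
      forall d, is_crossing d -> order turn d = 4%N].

Definition well_bounded : Prop :=
  [/\ forall d, outer (walk d) = outer d,
      forall d, exists2 d', connect (@link G) d d' & outer d' &
      forall d d', connect (@link G) d d' -> outer d -> outer d' ->
        fconnect (@walk G) d d'].

Definition crossing_number : nat := (#|[pred d : G | is_crossing d]| %/ 4)%N.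

Definition draws (g : bigraph K) : Prop :=
  [/\ well_drawn, well_bounded &
  exists (f1 : first_class g -> fst_vertex G)
         (f2 : second_class g -> snd_vertex G) (fe : edge g -> G),
    [/\ bijective f1, bijective f2, injective fe &
    [/\ forall d, is_fst d <-> (exists e, d = fe e),
        forall e, org (fe e) = Some (inl (f1 (first_end e))),
        forall e, exists2 d, on_strand (fe e) d &
          org (flip d) = Some (inr (f2 (second_end e))),
        forall e, wt (fe e) = weight e &
        forall d, exists e, on_strand (fe e) d \/ on_strand (fe e) (flip d)]]].

(* every edge takes part in at most one crossing *)
Definition crossed_once : Prop :=
  forall d, is_crossing d -> ~~ is_crossing (flip d).

Definition uncrossed : Prop := forall d, ~~ is_crossing d.

End Drawings.

Definition minimal_drawing K (g : bigraph K) (G : drawing K) : Prop :=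
  draws G g /\
  forall G' : drawing K, draws G' g -> (crossing_number G <= crossing_number G')%N.

Definition weaken (A B : Type) (o : option (A + B)) :
    option (option A + option B) :=
  match o with
  | Some (inl a) => Some (inl (Some a))
  | Some (inr b) => Some (inr (Some b))
  | None => None
  end.

(* Tripling.  New darts: XY is the one from X to (or towards) Y. *)
Variant tdart := UY | UW | WU | WV.

Definition tdart_code (x : tdart) : 'I_4 :=
  inord (match x with UY => 0 | UW => 1 | WU => 2 | WV => 3 end).
Definition tdart_decode (i : 'I_4) : tdart :=
  match val i with 0%N => UY | 1%N => UW | 2%N => WU | _ => WV end.
Lemma tdart_codeK : cancel tdart_code tdart_decode.
Proof. by case; rewrite /tdart_decode /= inordK. Qed.
HB.instance Definition _ := Finite.copy tdart (can_type tdart_codeK).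

Section Triple.
Variables (K : nzRingType) (G : drawing K).

(* [dv] is the dart at v of an edge between v and y; [s1] and [s2] are darts
   along this edge, directed from y to v.  The new vertex u is placed on s1,
   the new vertex w on s2, between u and v. *)
Variables s1 s2 dv : G.

Definition triple_ok : Prop :=
  (exists2 dy, is_snd dy & on_strand dy s1) /\
  [/\ on_strand s1 s2, on_strand s2 (flip dv) & is_fst dv].

Definition triple_flip (d : G + tdart) : G + tdart :=
  match d with
  | inl d =>
      if d == s1 then inr UY
      else if d == flip s2 then inr WV
      else if d == flip s1 then inr UW
      else if d == s2 then inr WU
      else inl (flip d)
  | inr UY => inl s1
  | inr UW => if s1 == s2 then inr WU else inl (flip s1)
  | inr WU => if s1 == s2 then inr UW else inl s2
  | inr WV => inl (flip s2)
  end.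

Definition triple_turn (d : G + tdart) : G + tdart :=
  match d with
  | inl d => inl (turn d)
  | inr UY => inr UW
  | inr UW => inr UY
  | inr WU => inr WV
  | inr WV => inr WU
  end.

Definition triple : drawing K :=
  @Drawing K
    (@PlaneMap (G + tdart)%type triple_flip triple_turn)
    (option (fst_vertex G)) (option (snd_vertex G))
    (fun d => match d with
      | inl d => weaken (org d)
      | inr (UY | UW) => Some (inl None)
      | inr (WU | WV) => Some (inr None)
      end)
    (fun d => match d with
      | inl d => if d == dv then 1 else wt d
      | inr UY => wt dv
      | inr UW => -1
      | inr (WU | WV) => 0
      end)
    (fun d => match d with
      | inl d => outer d
      | inr UY => outer (flip s1)
      | inr UW => outer s1
      | inr WU => outer (flip s2)
      | inr WV => outer s2
      end).

End Triple.

Inductive triplings (K : nzRingType) (G : drawing K) : drawing K -> Prop :=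
| triplings_none : triplings G G
| triplings_step (H : drawing K) (s1 s2 dv : H) :
    triplings G H -> triple_ok s1 s2 dv -> triplings G (triple s1 s2 dv).

(* Butterflies.  New darts, again from the first to the second end. *)
Variant bdart := B_wu | B_uw | B_pq | B_qp | B_pq' | B_qp'.

Definition bdart_code (x : bdart) : 'I_6 :=
  inord (match x with
         B_wu => 0 | B_uw => 1 | B_pq => 2 | B_qp => 3 | B_pq' => 4 | B_qp' => 5
         end).
Definition bdart_decode (i : 'I_6) : bdart :=
  match val i with
  | 0%N => B_wu | 1%N => B_uw | 2%N => B_pq | 3%N => B_qp | 4%N => B_pq'
  | _ => B_qp'
  end.
Lemma bdart_codeK : cancel bdart_code bdart_decode.
Proof. by case; rewrite /bdart_decode /= inordK. Qed.
HB.instance Definition _ := Finite.copy bdart (can_type bdart_codeK).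

(* The dart [c] issues from a crossing point; going around this point
   counterclockwise, the darts cp = c, cq, cq', cp' lead to vertices
   p, q, q', p' with p, p' in the first class and q, q' in the second, so that
   the edge pq' crosses the edge p'q:

       p' ---- q'                     p' ------- q'
         \    /                       | \     /  |
          \  /                        |  w---u   |
          /  \                        | /     \  |
       p ----- q   (no sides yet)     p -------- q

   The drawing of the butterfly is symmetric in the two edges: cp, cp' become
   darts at w and cq, cq' darts at u, and the new darts are those of uw and of
   the sides pq and p'q'.  Only the weights depend on which edge is called p1q2
   (weight a): it is pq' if [sw] is false, and p'q if [sw] is true. *)
Section Butterfly.
Variables (K : nzRingType) (G : drawing K).
Variables (c : G) (sw : bool).

Let cp : G := c.
Let cq : G := turn c.
Let cq' : G := turn (turn c).
Let cp' : G := turn (turn (turn c)).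
Let dp : G := flip cp.
Let dq : G := flip cq.
Let dq' : G := flip cq'.
Let dp' : G := flip cp'.

Definition butterfly_ok : Prop :=
  is_crossing c /\ [/\ is_fst dp, is_snd dq, is_snd dq' & is_fst dp'].

Definition butterfly_flip (d : G + bdart) : G + bdart :=
  match d with
  | inl d => inl (flip d)
  | inr B_wu => inr B_uw
  | inr B_uw => inr B_wu
  | inr B_pq => inr B_qp
  | inr B_qp => inr B_pq
  | inr B_pq' => inr B_qp'
  | inr B_qp' => inr B_pq'
  end.

(* The side pq comes just before dp at p and just after dq at q; the side p'q'
   comes just after dp' at p' and just before dq' at q'. *)
Let before (d : G) : G + bdart :=
  if d == dp then inr B_pq else if d == dq' then inr B_qp' else inl d.

Definition butterfly_turn (d : G + bdart) : G + bdart :=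
  match d with
  | inl d =>
      if d == cp then inr B_wu
      else if d == cp' then inl cp
      else if d == cq then inl cq'
      else if d == cq' then inr B_uw
      else if d == dq then inr B_qp
      else if d == dp' then inr B_pq'
      else before (turn d)
  | inr B_wu => inl cp'
  | inr B_uw => inl cq
  | inr B_pq => inl dp
  | inr B_qp => before (turn dq)
  | inr B_pq' => before (turn dp')
  | inr B_qp' => inl dq'
  end.

Let a : K := if sw then wt dp' else wt dp.
Let b : K := if sw then wt dp else wt dp'.

Definition butterfly : drawing K :=
  @Drawing K
    (@PlaneMap (G + bdart)%type butterfly_flip butterfly_turn)
    (option (fst_vertex G)) (option (snd_vertex G))
    (fun d => match d with
      | inl d =>
          if (d == cp) || (d == cp') then Some (inr None)
          else if (d == cq) || (d == cq') then Some (inl None)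
          else weaken (org d)
      | inr B_wu => Some (inr None)
      | inr B_uw => Some (inl None)
      | inr B_pq => weaken (org dp)
      | inr B_qp => weaken (org dq)
      | inr B_pq' => weaken (org dp')
      | inr B_qp' => weaken (org dq')
      end)
    (fun d => match d with
      | inl d =>
          if d == dp then (if sw then - b else 1)
          else if d == dp' then (if sw then 1 else - b)
          else if d == cq then (if sw then a else -1)
          else if d == cq' then (if sw then -1 else a)
          else wt d
      | inr B_uw => -1
      | inr B_pq => if sw then a * b else 1
      | inr B_pq' => if sw then 1 else a * b
      | inr (B_wu | B_qp | B_qp') => 0
      end)
    (fun d => match d with
      | inl d => if d \in [:: dq; cp; dp'; cq'] then false else outer d
      | inr B_qp => outer dq
      | inr B_pq' => outer dp'
      | inr (B_wu | B_uw | B_pq | B_qp') => false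
      end).

End Butterfly.

Inductive butterflies (K : nzRingType) (G : drawing K) : drawing K -> Prop :=
| butterflies_none : butterflies G G
| butterflies_step (H : drawing K) (c : H) (sw : bool) :
    butterflies G H -> butterfly_ok c -> butterflies G (butterfly c sw).

(* From here on the drawing has no crossings, so that the edges are the pairs
   {d, flip d}. *)
Section Dimers.
Variables (K : comNzRingType) (G : drawing K).
Implicit Types (d : G) (T S m : {set G}).

Definition tree_link T : rel G :=
  fun x y => (turn x == y) || ((x \in T) && (flip x == y)).

(* T spans (each component of) the graph, and each of its edges is a bridge *)
Definition spanning_tree T : Prop :=
  [/\ forall d, (flip d \in T) = (d \in T),
      forall d, connect (tree_link T) d (flip d) &
      forall d, d \in T ->
        ~~ connect (tree_link (T :\: [set d; flip d])) d (flip d)].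

(* eps d = true means that the edge of d has sign -1 *)
Variable eps : G -> bool.

Definition kasteleyn_face d : Prop :=
  let negatives := #|[set d' in left_face d | eps d']| in
  (#|left_face d| = 0 %[mod 4] -> odd negatives) /\
  (#|left_face d| = 2 %[mod 4] -> ~~ odd negatives).

(* [signed S]: S is the set of edges that have a sign at some stage of the
   spanning tree algorithm.  In a step, the bounded face to the left of d is a
   leaf of what remains of the dual tree: all its edges but that of d have a
   sign already, and the sign of d is such that this face satisfies the
   Kasteleyn condition. *)
Inductive signed : {set G} -> Prop :=
| signed_tree T : spanning_tree T -> signed T
| signed_prune S d : signed S -> d \notin S -> ~~ outer d ->
    (forall d', d' \in left_face d -> d' != d -> d' \in S) ->
    kasteleyn_face d -> signed (d |: (flip d |: S)).

Definition spanning_tree_weighting : Prop :=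
  (forall d, eps (flip d) = eps d) /\ signed [set: G].

Definition dimer_covering m : bool :=
  [&& [forall d in m, is_fst d],
      [forall v : fst_vertex G, #|[set d in m | org d == Some (inl v)]| == 1%N] &
      [forall v : snd_vertex G,
        #|[set d in m | org (flip d) == Some (inr v)]| == 1%N]].

Definition partition_function : K :=
  \sum_(m : {set G} | dimer_covering m) \prod_(d in m) ((-1) ^+ eps d * wt d).

End Dimers.

(* Main.v *)
(* Fox calculus turns the relator S W^-1 N E^-1 of a crossing into the row
   [S] - tX[W] + tX[N] - [E], so M' is the biadjacency matrix of the twisted
   graph up to a sign for each row and column: the parity of psi on the loop of a
   face is a checkerboard colouring.  Tripling and butterflies each adjoin a row
   and a column meeting in -1 whose Schur complement is the previous matrix, so
   they only change the sign of the determinant.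

   For the last graph, the partition function with Kasteleyn signs equals the
   determinant up to sign.  The planarity that this needs is supplied by the
   spanning tree algorithm itself: its leaf-pruning order shows that every cycle
   is a combination of Kasteleyn faces, so two matchings differ by the boundary of
   a height function on such faces.  Peeling off the top level reduces to matchings
   that differ by the boundary of a set of faces, and for these the comparison of
   signs comes from writing a rotation of the corners around each vertex as a
   product of the face permutation, of edge flips and of a permutation of the
   boundary: the number of orbits of the rotation is even because the matching
   pairs the vertices. *)
Require Import Defs.
From mathcomp Require Import all_boot all_order all_algebra fingroup perm ring zify.
Set Implicit Arguments.
Unset Strict Implicit.
Unset Printing Implicit Defensive.
Import Order.TTheory GRing.Theory Num.Theory.
Local Open Scope ring_scope.

(** * Permutation signs and faces of plane maps *)

Local Arguments walk {M} d.
Local Arguments left_face {M} d.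

(** The classical comparison of signs counts the vertices enclosed by a cycle, which requires discs.
    Here the region is any union of Kasteleyn faces, possibly disconnected or with holes, and the
    count becomes a parity identity. Let V be the number of vertices with a corner in the region, F
    the number of its faces, I that of its inner edges, A that of the boundary edges in the first
    matching, and s the parity of the permutation comparing the two matchings. The three factors of
    the rotation have parities F, I and A + s, on an even number of darts, so V = F + I + A + s mod
    2, and V is even. A Kasteleyn face with 2b darts has b + 1 negative signs mod 2; summed over the
    region this gives F + I + A, and inner edges count twice, so F + I + A is also the parity of the
    negative boundary edges. Hence s is that parity.

    Before the crossings are removed, an edge is a strand made of several darts. Only its two end
    darts are tracked through triplings and butterflies, together with the fact that a strand joins
    them. *)

Section PlaneMapFaces.
Variables (M : plane_map).
Hypotheses (flipK : involutive (@flip M)) (turn_inj : injective (@turn M)).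
Implicit Types d e : M.

Lemma turn_walk d : turn (walk d) = flip d.
Proof. exact: f_finv. Qed.

Lemma walk_flip_turn d : walk (flip (turn d)) = d.
Proof. by rewrite /walk flipK finv_f. Qed.

Lemma walk_inj : injective (@walk M).
Proof. by move=> x y /(congr1 turn); rewrite !turn_walk => /(inv_inj flipK). Qed.

Lemma left_face_eq d e : (left_face d == left_face e) = fconnect walk d e.
Proof.
have sym := fconnect_sym walk_inj.
apply/eqP/idP => [/setP/(_ e)|de]; first by rewrite !inE connect0.
by apply/setP=> x; rewrite !inE (same_connect sym de).
Qed.

Lemma left_face_closed d e : (walk e \in left_face d) = (e \in left_face d).
Proof. by rewrite !inE (same_connect_r (fconnect_sym walk_inj) (fconnect1 _ e)). Qed.

End PlaneMapFaces.

(** Both images are in bijection with the set of pairs of labels. *)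
Lemma card_imset_eq_kernel (T L1 L2 : finType) (f : T -> L1) (g : T -> L2)
    (Y : {set T}) :
    {in Y &, forall x y, (f x == f y) = (g x == g y)} ->
  #|f @: Y| = #|g @: Y|.
Proof.
move=> fgP; pose P := [set (f x, g x) | x in Y].
have -> : f @: Y = fst @: P.
  by rewrite -imset_comp.
have -> : g @: Y = snd @: P.
  by rewrite -imset_comp.
have fst_inj : {in P &, injective fst}.
  move=> ? ? /imsetP[x xY ->] /imsetP[y yY ->] /= /eqP fE.
  by move: (fE); rewrite fgP // => /eqP ->; rewrite (eqP fE).
have snd_inj : {in P &, injective snd}.
  move=> ? ? /imsetP[x xY ->] /imsetP[y yY ->] /= /eqP gE.
  by move: (gE); rewrite -fgP // => /eqP ->; rewrite (eqP gE).
by rewrite (card_in_imset fst_inj) (card_in_imset snd_inj).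
Qed.

(** The sign is the parity of the number of points minus the number of orbits. Fixed points outside
    [Y] cancel from this difference, and labels count the orbits inside. *)
Lemma odd_perm_labelled (T L : finType) (s : {perm T}) (Y : {set T})
    (l : T -> L) :
    perm_on Y s ->
    {in Y &, forall x y, (x \in porbit s y) = (l x == l y)} ->
  odd_perm s = odd #|Y| (+) odd #|l @: Y|.
Proof.
move=> sY sl; rewrite /odd_perm.
have -> : #|porbits s| = (#|l @: Y| + #|~: Y|)%N.
  have fixC x : x \notin Y -> porbit s x = [set x].
    move=> xY; apply/setP=> y; rewrite inE; apply/porbitP/eqP => [[i ->]|->].
      by rewrite permX_fix // (out_perm sY).
    by exists 0%N; rewrite expg0 perm1.
  have -> : porbits s = (porbit s @: Y) :|: (set1 @: ~: Y).
    apply/setP=> O; rewrite inE; apply/imsetP/orP.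
      case=> x _ ->; case: (boolP (x \in Y)) => xY.
        by left; apply: imset_f.
      by right; rewrite fixC //; apply: imset_f; rewrite inE.
    case=> /imsetP[x xY ->]; first by exists x.
    by exists x => //; rewrite fixC //; move: xY; rewrite inE.
  rewrite cardsU.
  have -> : (porbit s @: Y) :&: (set1 @: ~: Y) = set0.
    apply/setP=> O; rewrite !inE; apply/negP=> /andP[/imsetP[x xY ->]].
    case/imsetP=> y; rewrite inE => yY Oe.
    by move: (porbit_id s x); rewrite Oe inE => /eqP xy; rewrite -xy xY in yY.
  rewrite cards0 subn0; congr (_ + _)%N.
    by apply: card_imset_eq_kernel => x y xY yY; rewrite eq_porbit_mem sl.
  by rewrite card_imset //; apply: set1_inj.
by rewrite oddD -(cardsC Y) oddD; do 3 case: odd.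
Qed.

(** [A] contains exactly one point of each 2-cycle; this point serves as the label of its cycle. *)
Lemma odd_perm_involution (T : finType) (s : {perm T}) (A : {set T}) :
    (forall x, s (s x) = x) -> {in A, forall x, s x \notin A} ->
    (forall x, s x != x -> (x \in A) || (s x \in A)) ->
  odd_perm s = odd #|A|.
Proof.
move=> sK sA supp; pose Y := A :|: s @: A.
have memY x : (x \in Y) = (x \in A) || (s x \in A).
  rewrite inE; congr orb; apply/imsetP/idP => [[a aA ->]|sxA]; first by rewrite sK.
  by exists (s x); rewrite ?sK.
pose l x := if x \in A then x else s x.
have sY : perm_on Y s by apply/subsetP=> x; rewrite inE memY; apply: supp.
have -> : odd_perm s = odd #|Y| (+) odd #|l @: Y|.
  apply: odd_perm_labelled => // x y; rewrite !memY => xY yY.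
  have orb : (x \in porbit s y) = (x == y) || (x == s y).
    apply/porbitP/orP => [[i ->]|[]/eqP->].
    - elim: i => [|i [/eqP IH|/eqP IH]]; first by left; rewrite expg0 perm1.
        by right; rewrite expgSr permM IH.
      by left; rewrite expgSr permM IH sK.
    - by exists 0%N; rewrite expg0 perm1.
    - by exists 1%N; rewrite expg1.
  rewrite orb /l; case: ifP => xA; case: ifP => yA; rewrite ?xA ?yA /= in xY yY.
  - case: eqP => //= _; apply/negbTE; apply/eqP=> xE; move: (sA _ yA).
    by rewrite -xE xA.
  - by case: eqP => [xE|]; rewrite // xE yA in xA.
  - rewrite -(inj_eq (@perm_inj _ s) x (s y)) sK orbC.
    by case: eqP => //= _; apply/eqP => xE; rewrite xE yA in xA.
  - rewrite (inj_eq perm_inj); case: eqP => //= _.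
    by apply/negbTE; apply/eqP=> xE; rewrite xE yY in xA.
have lY : l @: Y = A.
  apply/setP=> x; apply/imsetP/idP.
    by case=> y; rewrite memY /l => /orP[] yA ->; rewrite ?yA //; case: ifP.
  by move=> xA; exists x; rewrite ?memY ?xA // /l xA.
have Y0 : A :&: s @: A = set0.
  apply/setP=> x; rewrite !inE; apply/negP=> /andP[xA /imsetP[y yA xE]].
  by move: (sA _ yA); rewrite -xE xA.
by rewrite lY cardsU Y0 cards0 subn0 card_imset ?oddD; [case: odd | apply: perm_inj].
Qed.

(** Induction on a decomposition of [p] into transpositions, each carried over to [T] by [h]. *)
Lemma odd_perm_extend (I T : finType) (h : I -> T) (p : {perm I})
    (s : {perm T}) :
    injective h -> (forall i, s (h i) = h (p i)) ->
    (forall x, x \notin codom h -> s x = x) ->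
  odd_perm s = odd_perm p.
Proof.
move=> h_inj; have [ts -> _] := prod_tpermP p.
elim: ts s => [|[i j] ts IH] s sh sid.
  rewrite big_nil odd_perm1.
  suff -> : s = 1%g by rewrite odd_perm1.
  apply/permP=> x; rewrite perm1; case: (boolP (x \in codom h)) => [/codomP[i ->]|/sid //].
  by rewrite sh big_nil perm1.
rewrite big_cons odd_mul_tperm -(IH (tperm (h i) (h j) * s)%g) /=.
- by rewrite odd_mul_tperm addbA (inj_eq h_inj) addbb.
- move=> k; rewrite permM.
  have -> : tperm (h i) (h j) (h k) = h (tperm i j k) by rewrite inj_tperm.
  by rewrite sh big_cons permM /= tpermK.
move=> x xh; rewrite permM tpermD; first exact: sid.
  by apply: contraNneq xh => <-; apply: codom_f.
by apply: contraNneq xh => <-; apply: codom_f.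
Qed.

(** * Kasteleyn signs *)

(** What the sign argument retains of a drawing without crossings: vertices are both the fibres of
    [org] and the orbits of [turn], and each edge {d, flip d} joins the two classes. *)
Record bipartite_map (K : Type) (G : drawing K) : Prop := BipartiteMap {
  bm_flipK : involutive (@flip G);
  bm_turn_inj : injective (@turn G);
  bm_org_turn : forall d : G, org (turn d) = org d;
  bm_org_connect : forall d d' : G, org d = org d' -> fconnect turn d d';
  bm_fst_flip : forall d : G, is_fst (flip d) = ~~ is_fst d;
  bm_uncrossed : uncrossed G }.

Section Kasteleyn.
Variables (K : comNzRingType) (G : drawing K) (G_bip : bipartite_map G).
Implicit Types (d e : G) (P Y m : {set G}).

Let flipK : involutive (@flip G) := bm_flipK G_bip.
Let turn_inj : injective (@turn G) := bm_turn_inj G_bip.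
Let org_turn d : org (turn d) = org d := bm_org_turn G_bip d.
Let fst_flip d : is_fst (flip d) = ~~ is_fst d := bm_fst_flip G_bip d.
Let flip_inj : injective (@flip G) := inv_inj flipK.

Let turn_walk := turn_walk turn_inj.
Let walk_flip_turn := walk_flip_turn flipK turn_inj.
Let walk_inj := walk_inj flipK turn_inj.
Let left_face_eq := left_face_eq flipK turn_inj.
Let left_face_closed := left_face_closed flipK turn_inj.

Lemma org_walk d : org (walk d) = org (flip d).
Proof. by rewrite -turn_walk org_turn. Qed.

Lemma eq_org_fst d e : org d = org e -> is_fst d = is_fst e.
Proof. by rewrite /is_fst => ->. Qed.

Lemma fst_walk d : is_fst (walk d) = ~~ is_fst d.
Proof. by rewrite (eq_org_fst (org_walk d)) fst_flip. Qed.

Lemma iter_walk_invariant (u : pred G) : (forall d, u (walk d) = u d) ->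
  forall d e, fconnect walk d e -> u e = u d.
Proof. by move=> uw d e /iter_findex <-; elim: findex => //= n; rewrite uw. Qed.

Lemma card_fst_half (s : G -> G) P : injective s ->
    (forall d, is_fst (s d) = ~~ is_fst d) ->
    (forall d, (s d \in P) = (d \in P)) ->
  #|[set d in P | ~~ is_fst d]| = #|[set d in P | is_fst d]|.
Proof.
move=> s_inj s_fst sP; apply/eqP; rewrite eqn_leq; apply/andP; split.
  rewrite -(card_imset _ s_inj); apply: subset_leq_card.
  by apply/subsetP=> _ /imsetP[d + ->]; rewrite !inE sP s_fst.
rewrite -(card_imset _ s_inj); apply: subset_leq_card.
by apply/subsetP=> _ /imsetP[d + ->]; rewrite !inE sP s_fst negbK.
Qed.

Lemma card_fstD P :
  #|P| = (#|[set d in P | is_fst d]| + #|[set d in P | ~~ is_fst d]|)%N.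
Proof.
rewrite -(cardsID [set d | is_fst d] P); congr (_ + _)%N; apply: eq_card => d.
  by rewrite !inE.
by rewrite !inE andbC.
Qed.

(** Applied to [flip] for sets of edges and to [walk] for unions of faces, both of which alternate
    between the classes. *)
Lemma card_double (s : G -> G) P : injective s ->
    (forall d, is_fst (s d) = ~~ is_fst d) ->
    (forall d, (s d \in P) = (d \in P)) ->
  #|P| = #|[set d in P | is_fst d]|.*2.
Proof. by move=> ? ? ?; rewrite card_fstD (@card_fst_half s) // addnn. Qed.

(** A covering contains only first-class darts. With both darts of each edge, every vertex of either
    class is the origin of exactly one, so the two classes can be treated alike. *)
Definition both_darts m : {set G} := [set d | (d \in m) || (flip d \in m)].

Lemma both_darts_flip m d : (flip d \in both_darts m) = (d \in both_darts m).
Proof. by rewrite !inE flipK orbC. Qed.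

Section Covering.
Variables (m : {set G}) (m_dimer : dimer_covering m).

Lemma dimer_fst d : d \in m -> is_fst d.
Proof. by case/and3P: m_dimer => /forallP/(_ d)/implyP. Qed.

Lemma both_darts_fst d : is_fst d -> (d \in both_darts m) = (d \in m).
Proof.
move=> df; rewrite inE; case: (boolP (flip d \in m)) => [/dimer_fst|_].
  by rewrite fst_flip df.
by rewrite orbF.
Qed.

Lemma both_darts_snd d : ~~ is_fst d -> (d \in both_darts m) = (flip d \in m).
Proof. by move=> df; rewrite -both_darts_flip both_darts_fst ?fst_flip. Qed.

Lemma both_darts_uniq d e :
  d \in both_darts m -> e \in both_darts m -> org d = org e -> d = e.
Proof.
move=> dm em de; have fE := eq_org_fst de.
case/and3P: m_dimer => _ /forallP m_fst /forallP m_snd.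
case: (boolP (is_fst d)) => df.
  rewrite both_darts_fst // in dm; rewrite both_darts_fst -?fE // in em.
  move: df; rewrite /is_fst; case dv: (org d) => [[v|//]|//] _.
  have /cards1P[x xE] := m_fst v.
  have : d \in [set x] by rewrite -xE inE dm dv eqxx.
  have : e \in [set x] by rewrite -xE inE em -de dv eqxx.
  by rewrite !inE => /eqP -> /eqP ->.
rewrite both_darts_snd // in dm; rewrite both_darts_snd -?fE // in em.
have := bm_uncrossed G_bip d; rewrite /is_crossing.
move: df; rewrite /is_fst; case dv: (org d) => [[//|v]|//] _ _.
have /cards1P[x xE] := m_snd v.
have : flip d \in [set x] by rewrite -xE inE dm flipK dv eqxx.
have : flip e \in [set x] by rewrite -xE inE em flipK -de dv eqxx.
by rewrite !inE => /eqP <- /eqP /flip_inj.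
Qed.

Lemma both_darts_exist d : exists2 e, e \in both_darts m & org e = org d.
Proof.
case/and3P: m_dimer => _ /forallP m_fst /forallP m_snd.
have := bm_uncrossed G_bip d; rewrite /is_crossing.
case: (org d) => [[v|v]|//] _.
  have /cards1P[x xE] := m_fst v; have := set11 x; rewrite -xE inE.
  by case/andP=> xm /eqP xv; exists x; rewrite ?inE ?xm.
have /cards1P[x xE] := m_snd v; have := set11 x; rewrite -xE inE.
by case/andP=> xm /eqP xv; exists (flip x); rewrite ?inE ?flipK ?xm ?orbT.
Qed.

(** The default [d] is never reached when [m] is a covering. *)
Definition dart_at d : G := odflt d [pick e in both_darts m | org e == org d].

Lemma dart_atP d : dart_at d \in both_darts m /\ org (dart_at d) = org d.
Proof.
rewrite /dart_at; case: pickP => [e /andP[? /eqP ?] //|].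
by have [e em eE] := both_darts_exist d => /(_ e); rewrite em eE eqxx.
Qed.

Lemma dart_atE d e : e \in both_darts m -> org e = org d -> dart_at d = e.
Proof.
move=> em eE; have [? E] := dart_atP d.
by apply: both_darts_uniq; rewrite // E eE.
Qed.

End Covering.

(** * Two matchings that differ along the boundary of a region *)

Section Exchange.
Variables (eps : G -> bool) (eps_flip : forall d, eps (flip d) = eps d).
Variables (m1 m2 : {set G}).
Hypotheses (m1P : dimer_covering m1) (m2P : dimer_covering m2).
Variable u : pred G.
Hypothesis u_walk : forall d, u (walk d) = u d.
Hypothesis u_kasteleyn : forall d, u d -> kasteleyn_face eps d.

(* The darts of the boundary of the region [u], with [u] on their left. *)
Definition rim d := u d && ~~ u (flip d).

Hypothesis rim_fst : forall d, is_fst d -> rim d = (d \in m1) && (d \notin m2).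
Hypothesis rim_flip_fst :
  forall d, is_fst d -> rim (flip d) = (d \in m2) && (d \notin m1).

Let S1 := both_darts m1.
Let S2 := both_darts m2.
Let Y := [set d | u d].
Let A := [set d in Y | rim d && is_fst d].
Let I := [set d in Y | u (flip d) && is_fst d].

Lemma u_flip_turn d : u (flip (turn d)) = u d.
Proof. by rewrite -u_walk walk_flip_turn. Qed.

Lemma rimE d :
  rim d = if is_fst d then (d \in S1) && (d \notin S2)
          else (d \in S2) && (d \notin S1).
Proof.
case: ifP => df; first by rewrite !both_darts_fst // rim_fst.
by rewrite !both_darts_snd ?df // -{1}[d]flipK rim_flip_fst ?fst_flip ?df.
Qed.

(** With the region on the left, the boundary leaves first-class vertices along [m1] and
    second-class ones along [m2], so the matching property applies. The boundary thus visits each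
    vertex at most once. *)
Lemma rim_uniq d e : rim d -> rim e -> org d = org e -> d = e.
Proof.
rewrite !rimE => + + de; rewrite -(eq_org_fst de).
by case: is_fst => /andP[dS _] /andP[eS _];
  [apply: (both_darts_uniq m1P) | apply: (both_darts_uniq m2P)].
Qed.

(* The dart following [d] on the boundary of [u], which alternates between [m1]
   and [m2]. *)
Definition rim_next d : G :=
  if rim d then dart_at (if is_fst d then m2 else m1) (flip d) else d.

(** If the next dart lay in both matchings, uniqueness at its origin would make it [flip d], and the
    edge of [d] would lie in both as well. *)
Lemma rim_next_in d : rim d -> rim (rim_next d).
Proof.
move=> dB; rewrite rimE /rim_next dB.
move: (dB); rewrite rimE.
case: ifP => df /andP[d1 d2].
  have [eS eE] := dart_atP m2P (flip d).
  rewrite (eq_org_fst eE) fst_flip df /= eS.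
  apply: contra d2 => e1; rewrite -both_darts_flip.
  rewrite -(both_darts_uniq m1P e1 _ eE) //.
  by rewrite both_darts_flip.
have [eS eE] := dart_atP m1P (flip d).
rewrite (eq_org_fst eE) fst_flip df /= eS.
apply: contra d2 => e1; rewrite -both_darts_flip.
rewrite -(both_darts_uniq m2P e1 _ eE) //.
by rewrite both_darts_flip.
Qed.

Lemma org_rim_next d : rim d -> org (rim_next d) = org (flip d).
Proof.
by rewrite /rim_next => ->; case: ifP => _;
  [case: (dart_atP m2P (flip d)) | case: (dart_atP m1P (flip d))].
Qed.

Lemma rim_next_id d : ~~ rim d -> rim_next d = d.
Proof. by rewrite /rim_next => /negbTE ->. Qed.

Lemma fst_rim_next d : rim d -> is_fst (rim_next d) = ~~ is_fst d.
Proof. by move=> /org_rim_next/eq_org_fst ->. Qed.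

Lemma rim_next_inj : injective rim_next.
Proof.
move=> d e; case: (boolP (rim d)) => dB; case: (boolP (rim e)) => eB E.
- have fE : is_fst d = is_fst e.
    by apply: negb_inj; rewrite -!fst_rim_next // E.
  have oE : org (flip d) = org (flip e) by rewrite -!org_rim_next // E.
  apply: flip_inj; move: dB eB; rewrite !rimE -fE.
  by case: ifP => df /andP[dS _] /andP[eS _];
    [apply: (both_darts_uniq m1P) | apply: (both_darts_uniq m2P)];
    rewrite ?both_darts_flip.
- by move: (rim_next_in dB); rewrite E rim_next_id // (negbTE eB).
- by move: (rim_next_in eB); rewrite -E rim_next_id // (negbTE dB).
- by rewrite !rim_next_id in E.
Qed.

Let nxt := perm rim_next_inj.

Lemma rim_prev_in d : rim ((nxt^-1)%g d) = rim d.
Proof.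
have [E|eB] := boolP (rim ((nxt^-1)%g d)).
  by rewrite -{1}(permKV nxt d) (permE rim_next_inj) rim_next_in.
by rewrite -{1}(permKV nxt d) (permE rim_next_inj) rim_next_id // (negbTE eB).
Qed.

Lemma fst_rim_prev d : rim d -> is_fst ((nxt^-1)%g d) = ~~ is_fst d.
Proof.
move=> dB; set e := (nxt^-1)%g d.
have -> : d = rim_next e by rewrite -(permE rim_next_inj) permKV.
by rewrite fst_rim_next ?negbK // rim_prev_in.
Qed.

Section Matching.
Variables (N : nat) (f : 'I_N -> fst_vertex G) (g : 'I_N -> snd_vertex G).
Hypotheses (f_bij : bijective f) (g_bij : bijective g).

Definition enumerates m (h : 'I_N -> G) (s : 'S_N) : Prop :=
  forall i, [/\ h i \in m, org (h i) = Some (inl (f i)) &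
    org (flip (h i)) = Some (inr (g (s i)))].

Variables (h1 h2 : 'I_N -> G) (s1 s2 : 'S_N).
Hypotheses (e1 : enumerates m1 h1 s1) (e2 : enumerates m2 h2 s2).

Lemma rim_next_back_proof :
  involutive (fun d => if rim d then if is_fst d then nxt d else (nxt^-1)%g d else d).
Proof.
move=> d /=; case: (boolP (rim d)) => dB; last by rewrite (negbTE dB).
case: (boolP (is_fst d)) => df.
  by rewrite !(permE rim_next_inj) rim_next_in // fst_rim_next // df /= -(permE rim_next_inj) permK.
by rewrite rim_prev_in dB fst_rim_prev // df permKV.
Qed.

(* Factoring this involution out of [nxt] leaves [nxt] squared on the darts of
   [m1], which is the permutation comparing the two matchings. *)
Let pairing := perm (inv_inj rim_next_back_proof).

Lemma odd_pairing : odd_perm pairing = odd #|A|.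
Proof.
apply: odd_perm_involution => [d|d|d].
- by rewrite !(permE (inv_inj rim_next_back_proof)) rim_next_back_proof.
- rewrite inE permE => /and3P[_ -> df]; rewrite df permE !inE.
  apply/negP=> /and3P[_ eB]; rewrite fst_rim_next ?df //.
  by apply: contraLR eB => dB; rewrite rim_next_id.
have u_of_rim e : rim e -> u e by case/andP.
rewrite permE; case: (boolP (rim d)) => dB; last by rewrite eqxx.
move=> _; rewrite !inE dB (u_of_rim _ dB) /=.
case: (boolP (is_fst d)) => //= df.
by rewrite rim_prev_in dB (u_of_rim ((nxt^-1)%g d)) ?rim_prev_in // fst_rim_prev.
Qed.

Lemma odd_rim_next : odd_perm nxt = odd #|A| (+) (odd_perm s1 (+) odd_perm s2).
Proof.
have -> : nxt = (pairing * (pairing^-1 * nxt))%g by rewrite mulKVg.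
rewrite odd_permM odd_pairing; congr addb.
rewrite -(odd_permV s2) -odd_permM.
have pV d : (pairing^-1)%g d = pairing d.
  by apply: (@perm_inj _ pairing); rewrite permKV
    !(permE (inv_inj rim_next_back_proof)) rim_next_back_proof.
have h1_inj : injective h1.
  move=> i j E; apply: (bij_inj f_bij).
  by have [_ + _] := e1 i; rewrite E; have [_ -> _] := e1 j => -[].
have fst_h1 i : is_fst (h1 i) by have [_ E _] := e1 i; rewrite /is_fst E.
have fst_h2 i : is_fst (h2 i) by have [_ E _] := e2 i; rewrite /is_fst E.
have nxtE d : nxt d = rim_next d by rewrite permE.
have pairE d : pairing d =
    if rim d then if is_fst d then nxt d else (nxt^-1)%g d else d.
  by rewrite permE.
(* Two steps of [nxt] lead from [h1 i] to the second-class vertex [g (s1 i)], then back along the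
   [m2] edge there to [f j] with [s2 j = s1 i], hence to [h1 j]. Off the boundary [h1 i] is also in
   [m2], and [j = i]. *)
apply: (odd_perm_extend h1_inj) => [i|d dh]; rewrite permM pV pairE.
  rewrite permM; set j := s2^-1%g (s1 i).
  have [hi1 hi hi'] := e1 i; have [hj2 hj hj'] := e2 j.
  have jE : s2 j = s1 i by rewrite permKV.
  case: (boolP (rim (h1 i))) => iB; rewrite ?fst_h1 ?nxtE; last first.
    have i2 : h1 i \in m2.
      by move: iB; rewrite rim_fst // hi1 negbK.
    have [hk2 hk hk'] := e2 i.
    have iE : h1 i = h2 i.
      by apply: (both_darts_uniq m2P); rewrite ?both_darts_fst ?hi.
    suff -> : j = i by rewrite rim_next_id.
    rewrite /j; apply: (canLR (permK s2)); apply: (bij_inj g_bij).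
    by move: hk'; rewrite -iE hi' => -[].
  have nE : rim_next (h1 i) = flip (h2 j).
    rewrite /rim_next iB fst_h1; apply: (dart_atE m2P).
      by rewrite both_darts_flip both_darts_fst.
    by rewrite hj' jE hi'.
  have nB := rim_next_in iB.
  rewrite /= [rim_next (rim_next _)]/rim_next nB fst_rim_next // fst_h1 /= nE flipK.
  apply: (dart_atE m1P); first by rewrite both_darts_fst //; case: (e1 j).
  by rewrite hj; case: (e1 j).
case: (boolP (rim d)) => dB; last by rewrite nxtE rim_next_id.
case: (boolP (is_fst d)) => df; last first.
  by rewrite permKV.
case/negP: dh; move: dB; rewrite rim_fst // => /andP[d1 _].
move: (df); rewrite /is_fst; case dv: (org d) => [[v|//]|//] _.
have [f' fK f'K] := f_bij; apply/codomP; exists (f' v).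
by apply: (both_darts_uniq m1P); rewrite ?both_darts_fst // ?dv;
  have [+ + _] := e1 (f' v); rewrite ?f'K.
Qed.

Lemma walk_within_inj : injective (fun d => if u d then walk d else d).
Proof.
move=> d e; case: (boolP (u d)) => du; case: (boolP (u e)) => eu //.
- exact: walk_inj.
- by move=> E; move: eu; rewrite -E u_walk du.
- by move=> E; move: du; rewrite E u_walk eu.
Qed.

Lemma flip_within_proof :
  involutive (fun d => if u d && u (flip d) then flip d else d).
Proof.
move=> d /=; case du: (u d && u (flip d)); last by rewrite du.
by rewrite flipK andbC du.
Qed.

Let walkp := perm walk_within_inj.
Let flipp := perm (inv_inj flip_within_proof).
(* Rotates about a vertex as [turn] does, skipping the sectors outside [u]. *)
Let rot := (walkp^-1 * flipp * nxt)%g.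

Lemma odd_walkp : odd_perm walkp = odd #|Y| (+) odd #|left_face @: Y|.
Proof.
apply: odd_perm_labelled.
  apply/subsetP=> d; rewrite !inE permE; apply: contraNT => /negbTE ->.
  by rewrite eqxx.
move=> d e _; rewrite inE => eu; rewrite eq_sym left_face_eq.
have iterE i : (walkp ^+ i)%g e = iter i walk e /\ u (iter i walk e).
  elim: i => [|i [IH iu]]; first by rewrite expg0 perm1.
  by rewrite expgSr permM IH permE iu iterS u_walk.
apply/porbitP/idP => [[i ->]|/iter_findex <-].
  by rewrite (iterE i).1 fconnect_iter.
by exists (findex walk e d); rewrite (iterE _).1.
Qed.

Lemma odd_flipp : odd_perm flipp = odd #|I|.
Proof.
have flippE d : flipp d = if u d && u (flip d) then flip d else d.
  by rewrite permE.
apply: odd_perm_involution => [d|d|d].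
- by rewrite !flippE flip_within_proof.
- rewrite !inE flippE. move=> /and3P[d1 d2 df]; by rewrite d1 d2 flipK fst_flip df !andbF.
- rewrite flippE !inE; case: ifP; last by rewrite eqxx.
  by rewrite flipK fst_flip => /andP[-> ->] _; case: is_fst.
Qed.

Lemma rot_turn d : u d -> u (turn d) -> rot d = turn d.
Proof.
move=> du tu; rewrite !permM.
have -> : (walkp^-1)%g d = flip (turn d).
  apply: (canLR (permK walkp)).
  by rewrite permE u_flip_turn du walk_flip_turn.
rewrite [flipp _]permE u_flip_turn du flipK tu /= permE rim_next_id //.
by rewrite /rim u_flip_turn du andbF.
Qed.

(** Here [flip (turn d)] is a boundary dart arriving at the vertex; [flipp] fixes it, and [nxt]
    continues with the boundary dart that leaves the vertex. This is the jump over the sectors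
    outside the region. *)
Lemma rot_rim d : u d -> ~~ u (turn d) -> rim (rot d) /\ org (rot d) = org d.
Proof.
move=> du tu; rewrite !permM.
have -> : (walkp^-1)%g d = flip (turn d).
  apply: (canLR (permK walkp)).
  by rewrite permE u_flip_turn du walk_flip_turn.
rewrite [flipp _]permE u_flip_turn du flipK (negbTE tu) /= permE.
have rimx : rim (flip (turn d)) by rewrite /rim u_flip_turn du flipK.
by rewrite org_rim_next // flipK org_turn rim_next_in.
Qed.

Lemma rot_id d : ~~ u d -> rot d = d.
Proof.
move=> du; rewrite !permM.
have -> : (walkp^-1)%g d = d.
  by apply: (canLR (permK walkp)); rewrite permE (negbTE du).
by rewrite [flipp _]permE (negbTE du) /= permE rim_next_id // /rim (negbTE du).
Qed.

Lemma odd_rot : odd_perm rot = odd #|Y| (+) odd #|org @: Y|.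
Proof.
apply: odd_perm_labelled.
  by apply/subsetP=> d; rewrite !inE; apply: contraNT => /rot_id ->.
have rot_in d : u d -> u (rot d) /\ org (rot d) = org d.
  move=> du; case: (boolP (u (turn d))) => tu.
    by rewrite rot_turn // org_turn.
  by have [/andP[]] := rot_rim du tu.
move=> d e; rewrite !inE => du eu; apply/porbitP/eqP => [[i ->]|de].
  suff [] : u ((rot ^+ i)%g e) /\ org ((rot ^+ i)%g e) = org e by [].
  elim: i => [|i [iu IH]]; first by rewrite expg0 perm1.
  by rewrite expgSr permM -IH; apply: rot_in.
apply/porbitP; set O := porbit rot e.
have O_rot x : x \in O -> rot x \in O.
  by case/porbitP=> i ->; apply/porbitP; exists i.+1; rewrite expgSr [RHS]permM.
have O_u x : x \in O -> u x /\ org x = org e.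
  case/porbitP=> i ->; elim: i => [|i [iu IH]]; first by rewrite expg0 perm1.
  by rewrite expgSr permM -IH; apply: rot_in.
have eO : e \in O by apply: porbit_id.
have ed := bm_org_connect G_bip (esym de).
(* [turn] passes through darts outside [u], where membership in [O] fails; [W] is to be a weaker
   property that [turn] preserves all the way from [e] to [d]. *)
suff [W We Wd] : exists2 W : pred G, W e &
    (forall x, W x -> W (turn x)) /\ (W d -> d \in O).
  apply: Wd.2; move: ed => /iter_findex <-.
  by elim: findex => //= n; apply: Wd.1.
(* If the orbit meets the boundary at [x], any re-entry into [u] at this vertex is along its only
   outgoing boundary dart, which is [rot x] and lies in [O]. Otherwise [rot] agrees with [turn] on
   [O]. *)
case: (pickP [pred x in O | ~~ u (turn x)]) => [x /andP[xO xu]|O_turn].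
  have [xu' xe] := O_u _ xO; have [bB be] := rot_rim xu' xu.
  exists (fun z => (org z == org e) && (u z ==> (z \in O))).
    by rewrite eqxx eO implybT.
  split=> [z /andP[/eqP ze /implyP zO]|/andP[_ /implyP]]; last exact.
  rewrite org_turn ze eqxx /=; apply/implyP=> tu.
  case: (boolP (u z)) => zu; first by rewrite -rot_turn // O_rot // zO.
  suff -> : turn z = rot x by apply: O_rot.
  apply: rim_uniq => //; first by rewrite /rim tu u_flip_turn zu.
  by rewrite org_turn be ze xe.
exists (mem O) => //; split=> // x xO.
have [xu _] := O_u _ xO; rewrite /= -rot_turn //; first exact: O_rot.
have xO' : x \in O := xO.
by move: (O_turn x); rewrite inE xO' /= => /negbFE.
Qed.

(* The matching [m1] pairs the vertices that have a corner in the region [u]. *)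
Lemma odd_corner_vertices : odd #|org @: Y| = false.
Proof.
pose Z := [set d in S1 | u d || u (flip d)].
have -> : org @: Y = org @: Z.
  apply/setP=> v; apply/imsetP/imsetP => [] [d]; rewrite inE; last first.
    case/andP=> _ /orP[du ->|du ->]; first by exists d; rewrite ?inE.
    by exists (walk (flip d)); rewrite ?inE ?u_walk // org_walk flipK.
  move=> du ->; have [eS ed] := dart_atP m1P d.
  set e := dart_at m1 d in eS ed *.
  exists e => //; rewrite inE eS /=; apply: contraT; rewrite negb_or => /andP[eu eu'].
  have : fconnect turn d e by apply: (bm_org_connect G_bip).
  have : fconnect turn e d by apply: (bm_org_connect G_bip).
  (* Suppose the region touches the vertex but neither side of its [m1] edge. Turning about the
     vertex then enters and leaves the region, giving an outgoing and an incoming boundary dart. One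
     of their two edges is in [m1], which one depending on the class, so it is the edge of [e]: a
     contradiction. *)
  have leave x y : fconnect turn x y -> u x != u y ->
      exists2 z, org z = org x & (u z == u x) && (u (turn z) == u y).
    move=> xy; rewrite -(iter_findex xy); elim: findex => [|n IH]; first by rewrite eqxx.
    have on : org (iter n turn x) = org x.
      by elim: n {IH} => //= n IHn; rewrite org_turn.
    case: (boolP (u x == u (iter n turn x))) => [/eqP xn|xn].
      move=> _; exists (iter n turn x) => //.
      by rewrite /= xn !eqxx.
    rewrite /= => xu; have [z zx /andP[/eqP zu /eqP tu]] := IH xn.
    exists z => //; rewrite zu eqxx tu /=.
    by case: (u x) xn xu; case: (u _) => //; case: (u _).
  move=> /leave; rewrite du (negbTE eu) => /(_ isT)[x xe /andP[/eqP xu /eqP xu']].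
  move=> /leave; rewrite du (negbTE eu) => /(_ isT)[y yd /andP[/eqP yu /eqP yu']].
  have xB : rim (turn x) by rewrite /rim xu' u_flip_turn xu.
  have yB : rim (flip (turn y)) by rewrite /rim flipK u_flip_turn yu yu'.
  case: (boolP (is_fst e)) => ef.
    move: (xB); rewrite rimE (eq_org_fst (org_turn x)) (eq_org_fst xe) ef.
    case/andP=> xS _; move: xu'; rewrite (both_darts_uniq m1P xS eS) ?(negbTE eu) //.
    by rewrite org_turn.
  move: (yB); rewrite rimE fst_flip (eq_org_fst (org_turn y)) (eq_org_fst yd).
  rewrite -(eq_org_fst ed) ef /= => /andP[]; rewrite both_darts_flip => yS _.
  move: eu'; rewrite -(both_darts_uniq m1P yS eS) ?u_flip_turn ?yu //.
  by rewrite org_turn yd ed.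
rewrite card_in_imset => [|d e]; last first.
  by rewrite ![_ \in Z]inE => /andP[dS _] /andP[eS _]; apply: (both_darts_uniq m1P).
rewrite (@card_double flip) ?odd_double // => d.
by rewrite ![_ \in Z]inE both_darts_flip flipK [u _ || _]orbC.
Qed.

(** A face has 2b darts, b of them in the first class, so its length is 0 or 2 mod 4 according to
    the parity of b, and its negative signs number b + 1 mod 2. Then sum over the faces of the
    region. *)
Lemma exchange_face_count :
  odd #|[set d in Y | eps d]| =
  odd #|left_face @: Y| (+) odd #|[set d in Y | is_fst d]|.
Proof.
have count (P : pred G) :
    #|[set d in Y | P d]| = (\sum_(F in left_face @: Y) #|[set d in F | P d]|)%N.
  have countE (Q : {set G}) : #|[set d in Q | P d]| = (\sum_(d in Q) P d)%N.
    by rewrite -sum1dep_card big_mkcondr; apply: eq_bigr => d _; case: (P d).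
  rewrite countE (partition_big_imset left_face) /=.
  apply: eq_bigr => F /imsetP[e eY ->]; rewrite countE; apply: eq_bigl => d.
  rewrite eq_sym left_face_eq !inE; case: (boolP (fconnect walk e d)); last by rewrite andbF.
  by move/(iter_walk_invariant u_walk) ->; move: eY; rewrite inE => ->.
rewrite !count -sum1_card -oddD -big_split /=.
apply: (big_ind2 (fun a b => odd a = odd b)) => // [a a' b b' aE bE|F /imsetP[d + ->]].
  by rewrite !oddD aE bE.
rewrite inE => /u_kasteleyn[].
have := @card_double walk (left_face d) walk_inj fst_walk (left_face_closed d).
set b := #|[set e in left_face d | is_fst e]| => ->.
have m4 n : n.*2.*2 = (n * 4)%N by rewrite -!muln2 -mulnA.
rewrite oddD /= -(odd_double_half b); case: (odd b); rewrite doubleD /= => k0 k2.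
  have : ~~ odd #|[set e in left_face d | eps e]|.
    by apply: k2; rewrite m4 addnC modnMDl.
  by rewrite oddD odd_double => /negbTE.
have : odd #|[set e in left_face d | eps e]|.
  by apply: k0; rewrite add0n m4 modnMl.
by rewrite odd_double => ->.
Qed.

Lemma exchange_sign :
  odd #|[set d in m1 | eps d]| (+) odd #|[set d in m2 | eps d]| =
  odd_perm s1 (+) odd_perm s2.
Proof.
have half_Y : odd #|Y| = false.
  by rewrite (card_double walk_inj fst_walk) ?odd_double // => d; rewrite !inE u_walk.
have fst_Y : #|[set d in Y | is_fst d]| = (#|I| + #|A|)%N.
  rewrite -(cardsID [set d | u (flip d)]); congr (_ + _)%N.
    by apply: eq_card => d; rewrite !inE; case: (u d); case: (u (flip d)); case: is_fst.
  by apply: eq_card => d; rewrite !inE /rim; case: (u d); case: (u (flip d)); case: is_fst.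
have m12 (m m' : {set G}) : odd #|[set d in m | eps d]| =
    odd #|[set d in m :&: m' | eps d]| (+) odd #|[set d in m :\: m' | eps d]|.
  rewrite -(cardsID m') oddD; congr (odd _ (+) odd _); apply: eq_card => d;
  by rewrite !inE; case: (d \in m); case: (d \in m'); case: (eps d).
(* An inner edge contributes both of its darts, hence nothing mod 2; a boundary edge contributes
   one. *)
have eps_Y : odd #|[set d in Y | eps d]| =
    odd #|[set d in m1 :\: m2 | eps d]| (+) odd #|[set d in m2 :\: m1 | eps d]|.
  rewrite -(cardsID [set d | u (flip d)]) oddD.
  rewrite (@card_double flip) //; last first.
    move=> d; rewrite !inE flipK eps_flip.
    by case: (u d); case: (u (flip d)); case: (eps d).
  rewrite odd_double /= (card_fstD) oddD; congr (odd _ (+) odd _).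
    apply: eq_card => d; rewrite !inE.
    case: (boolP (is_fst d)) => df; rewrite ?andbT ?andbF.
      by move: (rim_fst df); rewrite /rim; case: (u d); case: (u (flip d));
        rewrite ?andbF //= => /esym; rewrite ?[(_ \notin _) && _]andbC => ->.
    by case: (boolP (d \in m1)) => [/(dimer_fst m1P)|]; rewrite ?andbF // (negbTE df).
  rewrite -(card_imset _ flip_inj); apply: eq_card => d.
  rewrite -[d]flipK (mem_imset _ _ flip_inj) !inE flipK eps_flip fst_flip negbK.
  case: (boolP (is_fst d)) => df; rewrite ?andbT ?andbF.
    by move: (rim_flip_fst df); rewrite /rim flipK; case: (u d); case: (u (flip d));
      rewrite ?andbF //= => /esym; rewrite ?[(_ \notin _) && _]andbC => ->.
  by case: (boolP (d \in m2)) => [/(dimer_fst m2P)|]; rewrite ?andbF // (negbTE df).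
have rotE : odd_perm rot = odd #|left_face @: Y| (+) odd #|I| (+)
    (odd #|A| (+) (odd_perm s1 (+) odd_perm s2)).
  by rewrite !odd_permM odd_permV odd_walkp odd_flipp odd_rim_next half_Y.
rewrite (m12 m1 m2) (m12 m2 m1) setIC addbACA addbb /= -eps_Y.
(* The left side of [rotE] vanishes mod 2; the terms for faces, inner edges and [A] match those of
   the Kasteleyn count, leaving the two permutations. *)
move: rotE; rewrite odd_rot half_Y odd_corner_vertices exchange_face_count fst_Y oddD.
by do 5 case: (odd _); case: (odd_perm s1); case: (odd_perm s2).
Qed.
End Matching.
End Exchange.

(** [flip (turn d)] lies on the same face as [d], so reindexing by [turn] identifies the two sums
    around the vertex. *)
Lemma walk_invariant_divergence (a : G -> int) v :
    (forall d, a (walk d) = a d) ->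
  \sum_(d | org d == v) (a d - a (flip d)) = 0.
Proof.
move=> aw; rewrite sumrB [X in _ - X](reindex_inj turn_inj) /=.
apply/eqP; rewrite subr_eq0; apply/eqP.
apply: eq_big => [d|d _]; first by rewrite org_turn.
by rewrite -[in RHS]aw walk_flip_turn.
Qed.

(** A matching seen as a unit flow from the first class to the second. The difference of two
    coverings is then a circulation. *)
Definition indicator m d : int := (d \in m)%:Z - (flip d \in m)%:Z.

Lemma indicator_flip m d : indicator m (flip d) = - indicator m d.
Proof. by rewrite /indicator flipK opprB. Qed.

Section Support.
Variables (m : {set G}) (m_fst : forall d, d \in m -> is_fst d).

Lemma indicator_fst d : is_fst d -> indicator m d = (d \in m)%:Z.
Proof.
move=> df; rewrite /indicator; case: (boolP (flip d \in m)) => [/m_fst|_].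
  by rewrite fst_flip df.
by rewrite subr0.
Qed.

Lemma cardz_fst v : \sum_(d | org d == Some (inl v)) indicator m d =
  #|[set d in m | org d == Some (inl v)]|%:Z.
Proof.
rewrite -sum1dep_card (big_morph Posz PoszD (erefl (Posz 0))) [RHS]big_mkcondl /=.
apply: eq_bigr => d /eqP dv.
rewrite indicator_fst; last by rewrite /is_fst dv.
by case: (d \in m).
Qed.

Lemma cardz_snd v : \sum_(d | org d == Some (inr v)) indicator m d =
  - #|[set d in m | org (flip d) == Some (inr v)]|%:Z.
Proof.
rewrite (reindex_inj flip_inj) -sum1dep_card.
rewrite (big_morph Posz PoszD (erefl (Posz 0))) -sumrN [RHS]big_mkcondl /=.
apply: eq_bigr => d /eqP dv; rewrite indicator_flip indicator_fst.
  by case: (d \in m).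
by rewrite -[is_fst d]negbK -fst_flip /is_fst dv.
Qed.

End Support.

(** For a set of first-class darts, the divergence at a vertex is, up to sign, the number of chosen
    edges there. *)
Lemma dimer_covering_indicator m m' : dimer_covering m ->
    (forall d, d \in m' -> is_fst d) ->
    (forall v, \sum_(d | org d == v) indicator m' d =
               \sum_(d | org d == v) indicator m d) ->
  dimer_covering m'.
Proof.
move=> mP m'_fst sumE; have m_fst := @dimer_fst m mP.
case/and3P: mP => _ /forallP m1 /forallP m2; apply/and3P; split.
- by apply/forallP=> d; apply/implyP/m'_fst.
- apply/forallP=> v; have /eqP := sumE (Some (inl v)).
  by rewrite !cardz_fst // (eqP (m1 v)).
- apply/forallP=> v; have /eqP := sumE (Some (inr v)).
  by rewrite !cardz_snd // eqr_opp (eqP (m2 v)).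
Qed.

(** * Circulations as height functions, and equality of signs for all matchings *)

Section Heights.
Variables (eps : G -> bool) (eps_flip : forall d, eps (flip d) = eps d).

Lemma signed_flip S d : signed eps S -> (flip d \in S) = (d \in S).
Proof.
move=> sS; elim: sS d => [T [TP _ _] //|S' d _ IH _ _ _ _ e].
by rewrite !inE IH (inj_eq flip_inj) (canF_eq flipK) orbCA.
Qed.

(* A bridge carries no flow, so a flow supported on a forest vanishes. *)
Lemma forest_flow T (z : G -> int) : spanning_tree T ->
    (forall d, z (flip d) = - z d) ->
    (forall v, \sum_(d | org d == v) z d = 0) ->
    (forall d, z d != 0 -> d \in T) ->
  forall d, z d = 0.
Proof.
move=> [TP _ bridge] zN z_div zT d; apply/eqP; apply: contraT => zd.
have dT := zT _ zd; have fdW := bridge _ dT.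
pose r := tree_link (T :\: [set d; flip d]).
pose W := [set e | connect r d e].
have W_org e e' : org e = org e' -> e \in W -> e' \in W.
  rewrite !inE => ee' de; apply: connect_trans de _.
  have := bm_org_connect G_bip ee'; apply: connect_sub => x y /eqP <-.
  by apply: connect1; rewrite /r /tree_link eqxx.
have W_sum : \sum_(e in W) z e = 0.
  rewrite (partition_big_imset org) /= big1 // => v /imsetP[e eW ->].
  rewrite -[RHS](z_div (org e)); apply: eq_bigl => e'.
  by case: eqP => [/esym/W_org/(_ eW) ->|]; rewrite ?andbF.
have dW : d \in W by rewrite inE connect0.
move: W_sum; rewrite (bigD1 d) //= => /eqP; rewrite addrC addr_eq0 => /eqP zE.
(* [W] is the side of the bridge containing the origin of [d]. Flow-carrying darts of [W] other than
   [d] have their reverse in [W] too and cancel in pairs, so only [z d] is left of a zero sum. *)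
pose Q := [pred e | [&& e \in W, e != d & e \in T]].
have sumQ : \sum_(e in W | e != d) z e = \sum_(e | Q e) z e.
  rewrite (bigID (fun e => e \in T)) /= [X in _ + X]big1 ?addr0.
    by apply: eq_bigl => e; rewrite /Q /= andbA.
  by move=> e /andP[_]; apply: contraNeq => /zT.
have Q_flip e : Q e -> Q (flip e).
  case/and3P=> eW ed eT; rewrite /Q /= TP eT andbT; apply/andP; split.
    rewrite inE; move: (eW); rewrite inE => /connect_trans; apply; apply: connect1.
    rewrite /r /tree_link eqxx andbT orbC !inE eT andbT negb_or ed.
    apply/orP; left; apply: contraNneq fdW => E.
    by move: eW; rewrite inE E.
  apply: contraNneq fdW => E.
  have eE : e = flip d by rewrite -E flipK.
  by rewrite eE inE in eW.
have Q_sum : \sum_(e | Q e) z e = - \sum_(e | Q e) z e.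
  rewrite {1}(reindex_inj flip_inj) -sumrN; apply: eq_big => [e|e _]; last exact: zN.
  by apply/idP/idP => /Q_flip; rewrite ?flipK.
have : - z d == 0 by rewrite -zE sumQ -eqNr -Q_sum.
by rewrite oppr_eq0 (negbTE zd).
Qed.

(** The sign assignment is undone step by step: subtracting [z d] times the boundary of the face
    pruned last clears the flow on its new edge, so the rest lives on the edges signed earlier.
    Nonzero heights occur only on pruned faces, which are Kasteleyn. *)
Lemma signed_heights S (z : G -> int) : signed eps S ->
    (forall d, z (flip d) = - z d) ->
    (forall v, \sum_(d | org d == v) z d = 0) ->
    (forall d, z d != 0 -> d \in S) ->
  exists c : G -> int, [/\ forall d, c (walk d) = c d,
    forall d, z d = c d - c (flip d) &
    forall d, c d != 0 -> kasteleyn_face eps d].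
Proof.
move=> sS; elim: sS z => [T T_tree|{}S d sS IH dS _ dF d_kast] z zN z_div zS.
  exists (fun=> 0); split=> // d.
  by rewrite subr0 (forest_flow T_tree).
pose F := left_face d; pose a e : int := (e \in F)%:Z.
have aw e : a (walk e) = a e by rewrite /a /F left_face_closed.
(* The new edge borders the face on one side only: otherwise [flip d] would be signed already, and
   with it [d]. *)
have ad : a d - a (flip d) = 1.
  rewrite /a !inE connect0; case: (boolP (fconnect _ _ _)) => //= fdF.
  have : flip d \in S.
    apply: dF; first by rewrite inE.
    by apply/eqP => E; have := fst_flip d; rewrite E; case: is_fst.
  by rewrite (signed_flip _ sS) (negbTE dS).
have aS e : e \notin d |: (flip d |: S) -> a e - a (flip e) = 0.
  move=> eS; have outF x : x \notin d |: (flip d |: S) -> a x = 0.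
    rewrite /a; case: (boolP (x \in F)) => // /dF xS; rewrite !inE !negb_or.
    by case/and3P=> /xS ->.
  rewrite !outF //; move: eS; rewrite !inE (signed_flip _ sS) (inj_eq flip_inj).

  by rewrite (canF_eq flipK) [X in _ -> ~~ X]orbCA.
have [||x|c [cw cE ck]] := IH (fun e => z e - z d * (a e - a (flip e))).
- by move=> e; rewrite zN flipK -(opprB (a e)) mulrN opprK opprB addrC.
- by move=> v; rewrite sumrB z_div -mulr_sumr walk_invariant_divergence // mulr0 subr0.
- apply: contraNT => xS.
  case: (boolP (x \in d |: (flip d |: S))) => [|xS'].
    rewrite !inE (negbTE xS) orbF => /orP[]/eqP->; first by rewrite ad mulr1 subrr.
    by rewrite flipK zN -(opprB (a d)) ad mulrN1 opprK addNr.
  by rewrite aS // mulr0 subr0; apply: contraNT xS' => /zS.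
exists (fun e => c e + z d * a e); split=> [e|e|e].
- by rewrite cw aw.
- rewrite opprD addrACA -cE -mulrBr subrK //.
- case: (boolP (e \in F)) => eF; last first.
    by rewrite /a (negbTE eF) mulr0 addr0 => /ck.
  have /eqP FE : left_face d == left_face e.
    by rewrite left_face_eq; move: eF; rewrite inE.
  by rewrite /kasteleyn_face -/F in d_kast *; rewrite -FE.
Qed.

Variables (N : nat) (f : 'I_N -> fst_vertex G) (g : 'I_N -> snd_vertex G).
Hypotheses (f_bij : bijective f) (g_bij : bijective g).

Lemma enumerates_exist m : dimer_covering m ->
  exists (h : 'I_N -> G) (s : 'S_N), enumerates f g m h s.
Proof.
move=> mP; have [g' gK g'K] := g_bij.
have ex i : exists d : G, exists j : 'I_N,
    [/\ d \in m, org d = Some (inl (f i)) & org (flip d) = Some (inr (g j))].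
  case/and3P: (mP) => _ /forallP/(_ (f i))/cards1P[d dE] _.
  have := set11 d; rewrite -dE inE => /andP[dm /eqP dv]; exists d.
  have := bm_uncrossed G_bip (flip d); have := fst_flip d.
  rewrite /is_crossing /is_fst dv; case: (org (flip d)) => [[v|v]|] // _ _.
  by exists (g' v); rewrite g'K.
have [h hP] := fin_all_exists ex; have [s sP] := fin_all_exists hP.
have s_inj : injective s.
  move=> i i' ii'; apply: (bij_inj f_bij).
  have [im iE iE'] := sP i; have [im' jE jE'] := sP i'.
  have : flip (h i) = flip (h i').
    apply: (both_darts_uniq mP); last by rewrite iE' jE' ii'.
      by rewrite both_darts_flip inE im.
    by rewrite both_darts_flip inE im'.
  by move/flip_inj=> hE; move: iE; rewrite hE jE => -[].
by exists h, (perm s_inj) => i; rewrite permE.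
Qed.

Definition same_sign m1 m2 : Prop :=
  forall h1 h2 s1 s2, enumerates f g m1 h1 s1 -> enumerates f g m2 h2 s2 ->
  odd #|[set d in m1 | eps d]| (+) odd #|[set d in m2 | eps d]| =
  odd_perm s1 (+) odd_perm s2.

Lemma same_sign_sym m1 m2 : same_sign m1 m2 -> same_sign m2 m1.
Proof. by move=> S h1 h2 s1 s2 E1 E2; rewrite addbC (S _ _ _ _ E2 E1) addbC. Qed.

(** [same_sign] is vacuous for a set that has no enumeration; a covering in the middle supplies
    one. *)
Lemma same_sign_trans m1 m2 m3 : dimer_covering m2 ->
  same_sign m1 m2 -> same_sign m2 m3 -> same_sign m1 m3.
Proof.
move=> m2P S12 S23 h1 h3 s1 s3 E1 E3.
have [h2 [s2 E2]] := enumerates_exist m2P.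
have := S12 _ _ _ _ E1 E2; have := S23 _ _ _ _ E2 E3.
by do 3 case: odd; do 3 case: odd_perm.
Qed.

Definition height_difference m1 m2 (c : G -> int) : Prop :=
  [/\ forall d, c (walk d) = c d,
      forall d, indicator m1 d - indicator m2 d = c d - c (flip d) &
      forall d, c d != 0 -> kasteleyn_face eps d].

Lemma height_difference_sym m1 m2 c :
  height_difference m1 m2 c -> height_difference m2 m1 (fun d => - c d).
Proof.
case=> cw cE ck; split=> [d|d|d]; first by rewrite cw.
  by rewrite -opprB cE opprB opprK addrC.
by rewrite oppr_eq0; apply: ck.
Qed.

Lemma absz_pred (x : int) : 0 < x -> `|x - 1|%N.+1 = `|x|%N.
Proof. by case: x => [[|n]|n] // _; rewrite intS addrAC subrr add0r. Qed.

(* [m1] is modified along the boundary of the highest level of [c]. *)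
Lemma lower_heights m1 m2 c d0 : dimer_covering m1 -> dimer_covering m2 ->
    height_difference m1 m2 c -> 0 < c d0 ->
  exists m c', [/\ dimer_covering m, same_sign m1 m, height_difference m m2 c' &
    (\sum_d `|c' d| < \sum_d `|c d|)%N].
Proof.
move=> m1P m2P [cw cE ck] d0_gt0.
have [top _ topP] := @arg_maxP _ _ _ d0 predT c isT.
pose u d := c d == c top.
have c_le d : c d <= c top by apply: topP.
have top_gt0 : 0 < c top by apply: lt_le_trans d0_gt0 _.
have u_walk d : u (walk d) = u d by rewrite /u cw.
have rim_gt d : rim u d -> c (flip d) < c d.
  by case/andP=> /eqP -> ud; rewrite lt_neqAle ud c_le.
have m1_fst := @dimer_fst m1 m1P; have m2_fst := @dimer_fst m2 m2P.
(* Heights drop strictly across the boundary of the top level, and a positive difference of two 0/1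
   values determines both. *)
have rim1 d : is_fst d -> rim u d -> (d \in m1) && (d \notin m2).
  move=> df /rim_gt; rewrite -subr_gt0 -cE !indicator_fst //.
  by case: (d \in m1); case: (d \in m2).
have rim2 d : is_fst d -> rim u (flip d) -> d \notin m1.
  move=> df /rim_gt; rewrite flipK -subr_lt0 -cE !indicator_fst //.
  by case: (d \in m1); case: (d \in m2).
(* [m1] with its boundary edges replaced by the alternate ones; as a flow, [m1] minus the boundary
   of the top level. *)
pose m := [set d | is_fst d && ((d \in m1) && ~~ rim u d || rim u (flip d))].
have m_fst d : d \in m -> is_fst d by rewrite inE => /andP[].
pose a d : int := (u d)%:Z.
have aw d : a (walk d) = a d by rewrite /a u_walk.
have rim_excl d : rim u d -> ~~ rim u (flip d).
  by case/andP=> ud _; rewrite /rim flipK ud andbF.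
have mE d : indicator m d = indicator m1 d - (a d - a (flip d)).
  wlog df : d / is_fst d.
    move=> W; case: (boolP (is_fst d)) => [/W //|df].
    have := W (flip d); rewrite fst_flip => /(_ df).
    rewrite !indicator_flip flipK => E; apply: oppr_inj; rewrite E; ring.
  rewrite !indicator_fst // inE df /=.
  have := rim1 d df; have := rim2 d df; rewrite /rim flipK /a.
  by case: (u d); case: (u (flip d)); case: (d \in m1) => //= H2 H1;
    first [by have := H1 isT | by have := H2 isT].
have mP : dimer_covering m.
  apply: (dimer_covering_indicator m1P m_fst) => v.
  by under eq_bigr do rewrite mE; rewrite sumrB (walk_invariant_divergence v aw) subr0.
exists m, (fun d => c d - a d); split=> //.
- move=> h1 h2 s1 s2; apply: (exchange_sign eps_flip m1P mP u_walk) => //.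
  + by move=> d /eqP du; apply: ck; rewrite du gt_eqF.
  + move=> d df; have := rim1 d df; have := @rim_excl d.
    rewrite inE df /=; case: (rim u d) => //= [/(_ isT)/negbTE -> /(_ isT)|].
      by rewrite orbF andbF => /andP[->].
    by case: (d \in m1).
  + move=> d df; have := rim2 d df; rewrite inE df /=.
    case: (rim u (flip d)) => [/(_ isT) ->|]; first by rewrite orbT.
    by rewrite orbF; case: (d \in m1) => //=; rewrite andbF.
- split=> [d|d|d]; first by rewrite cw aw.
    by rewrite mE addrAC cE [RHS]addrAC opprD opprK addrACA; ring.
  move=> cd; apply: ck; apply: contraNneq cd => cd.
  by rewrite cd /a /u cd [0 == c top]lt_eqF.
(* Every dart at the top level has positive height and loses exactly one; the other terms are
   unchanged. *)
rewrite (bigD1 top) //= [X in (_ < X)%N](bigD1 top) //= -addSn leq_add //.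
  by rewrite /a /u eqxx absz_pred.
apply: leq_sum => d _; rewrite /a /u; case: eqP => [->|]; last by rewrite subr0.
by rewrite -[leqRHS]absz_pred.
Qed.

(** Induction on the total absolute height. Negative heights become positive when the two matchings
    are exchanged. *)
Lemma height_same_sign m1 m2 c : dimer_covering m1 -> dimer_covering m2 ->
  height_difference m1 m2 c -> same_sign m1 m2.
Proof.
have [n] := ubnP (\sum_d `|c d|)%N; elim: n => // n IH in m1 m2 c *.
move=> cn m1P m2P cP.
case: (pickP (fun d => 0 < c d)) => [d cd|c_le0].
  have [m [c' [mP S c'P c'_lt]]] := lower_heights m1P m2P cP cd.
  apply: (same_sign_trans mP S); apply: (IH _ _ _ _ _ _ c'P) => //.
  exact: (leq_trans c'_lt).
case: (pickP (fun d => 0 < - c d)) => [d cd|c_ge0].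
  have [m [c' [mP S c'P c'_lt]]] :=
    lower_heights m2P m1P (height_difference_sym cP) cd.
  apply: same_sign_sym; apply: (same_sign_trans mP S); apply: (IH _ _ _ _ _ _ c'P) => //.
  apply: (leq_trans c'_lt); rewrite -ltnS; apply: leq_ltn_trans cn.
  by apply: leq_sum => e _; rewrite abszN.
have c0 d : c d = 0.
  apply/eqP; rewrite eq_le; have := c_le0 d; have := c_ge0 d.
  by rewrite oppr_gt0 => /negbT; rewrite -leNgt => -> /negbT; rewrite -leNgt => ->.
have mE d : is_fst d -> (d \in m1) = (d \in m2).
  move=> df; case: cP => _ /(_ d) + _.
  rewrite !c0 subrr !indicator_fst //; try exact: dimer_fst.
  by case: (d \in m1); case: (d \in m2).
(* At height zero the matchings coincide: the case of the empty region. *)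
move=> h1 h2 s1 s2; apply: (@exchange_sign eps eps_flip m1 m2 m1P m2P xpred0) => //.
  by move=> d /mE ->; rewrite andbN.
by move=> d /mE ->; rewrite andbN.
Qed.

Lemma kasteleyn_same_sign m1 m2 : signed eps [set: G] ->
  dimer_covering m1 -> dimer_covering m2 -> same_sign m1 m2.
Proof.
move=> sS m1P m2P.
have [|||c [cw cE ck]] := signed_heights (z := fun d => indicator m1 d - indicator m2 d) sS.
- by move=> d; rewrite !indicator_flip -opprB opprK addrC.
- move=> [[v|v]|]; last first.
  + by rewrite big1 // => d dv; have := bm_uncrossed G_bip d; rewrite /is_crossing (eqP dv).
  + rewrite sumrB !cardz_snd; try exact: dimer_fst.
    case/and3P: m1P => _ _ /forallP/(_ v)/eqP ->.
    by case/and3P: m2P => _ _ /forallP/(_ v)/eqP ->.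
  + rewrite sumrB !cardz_fst; try exact: dimer_fst.
    case/and3P: m1P => _ /forallP/(_ v)/eqP -> _.
    by case/and3P: m2P => _ /forallP/(_ v)/eqP -> _.
- by move=> d _; rewrite inE.
exact: (height_same_sign m1P m2P (c := c)).
Qed.

End Heights.

(** * The signed partition function as a determinant *)

Section Determinant.
Variables (eps : G -> bool) (eps_flip : forall d, eps (flip d) = eps d).
Variables (N : nat) (f : 'I_N -> fst_vertex G) (g : 'I_N -> snd_vertex G).
Hypotheses (f_bij : bijective f) (g_bij : bijective g).

Let joins i j d := (org d == Some (inl (f i))) && (org (flip d) == Some (inr (g j))).

Lemma enumerates_inj m h s : enumerates f g m h s -> injective h.
Proof.
move=> E i j hE; apply: (bij_inj f_bij).
by have [_ + _] := E i; rewrite hE; have [_ -> _] := E j => -[].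
Qed.

Lemma enumerates_imset m h s : dimer_covering m -> enumerates f g m h s ->
  h @: 'I_N = m.
Proof.
move=> mP E; apply/setP=> d; apply/imsetP/idP => [[i _ ->]|dm]; first by case: (E i).
have [f' _ f'K] := f_bij; move: (dimer_fst mP dm).
rewrite /is_fst; case dv: (org d) => [[v|//]|//] _; exists (f' v) => //.
have [hm hv _] := E (f' v); apply: (both_darts_uniq mP); rewrite ?inE ?hm ?dm //.
by rewrite hv dv f'K.
Qed.

Lemma enumerates_uniq m h s h' s' : dimer_covering m ->
  enumerates f g m h s -> enumerates f g m h' s' -> h =1 h' /\ s = s'.
Proof.
move=> mP E E'; have hE : h =1 h'.
  move=> i; have [im iE _] := E i; have [im' iE' _] := E' i.
  by apply: (both_darts_uniq mP); rewrite ?inE ?im ?im' // iE iE'.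
split=> //; apply/permP=> i; apply: (bij_inj g_bij).
by have [_ _] := E i; have [_ _] := E' i; rewrite hE => -> [].
Qed.

Lemma joins_dimer_covering (h : 'I_N -> G) (s : 'S_N) :
    (forall i, joins i (s i) (h i)) ->
  dimer_covering (h @: 'I_N) /\ enumerates f g (h @: 'I_N) h s.
Proof.
move=> hP; have E : enumerates f g (h @: 'I_N) h s.
  by move=> i; have /andP[/eqP ? /eqP ?] := hP i; split=> //; apply: imset_f.
split=> //; have h_inj := enumerates_inj E.
have [f' fK f'K] := f_bij; have [g' gK g'K] := g_bij.
apply/and3P; split.
- by apply/forallP=> d; apply/implyP=> /imsetP[i _ ->];
    rewrite /is_fst; have [_ -> _] := E i.
- apply/forallP=> v; apply/cards1P; exists (h (f' v)); apply/setP=> d; rewrite !inE.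
  apply/andP/eqP => [[/imsetP[i _ ->]]|->].
    by have [_ -> _] := E i => /eqP[<-]; rewrite fK.
  by have [-> -> _] := E (f' v); rewrite f'K.
- apply/forallP=> v; apply/cards1P; exists (h (s^-1 (g' v))%g).
  apply/setP=> d; rewrite !inE.
  apply/andP/eqP => [[/imsetP[i _ ->]]|->].
    by have [_ _ ->] := E i => /eqP[<-]; rewrite gK permK.
  by have [-> _ ->] := E (s^-1 (g' v))%g; rewrite permKV g'K.
Qed.

(** Entries are sums over parallel edges, so expanding the determinant chooses a permutation and one
    dart per row: exactly a covering with its enumeration. *)
Lemma partition_function_det : signed eps [set: G] ->
  exists b : bool, partition_function eps =
    (-1) ^+ b * \det (\matrix_(i, j) \sum_(d | joins i j d) wt d).
Proof.
move=> sS; pose W m : K := \prod_(d in m) wt d.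
have detE : \det (\matrix_(i, j) \sum_(d | joins i j d) wt d) =
    \sum_(p : 'S_N * {ffun 'I_N -> G} | [forall i, joins i (p.1 i) (p.2 i)])
      (-1) ^+ p.1 * W (p.2 @: 'I_N).
  rewrite /determinant.
  under eq_bigr => s _.
    under eq_bigr do rewrite mxE.
    rewrite bigA_distr_big_dep big_distrr /=.
    over.
  rewrite pair_big_dep /=; apply: eq_big => [[s h] /=|[s h] /=].
    by apply/familyP/forallP => H i; have := H i; rewrite ?inE.
  move=> /familyP hP; congr (_ * _); rewrite /W big_imset //=.
  have [_ E] := joins_dimer_covering (h := h) (s := s) hP.
  by move=> i j _ _; apply: (enumerates_inj E).
have WE m : dimer_covering m ->
    \prod_(d in m) ((-1) ^+ eps d * wt d) = (-1) ^+ odd #|[set d in m | eps d]| * W m.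
  move=> _; rewrite big_split /=; congr (_ * _).
  rewrite signr_odd -sum1dep_card big_mkcondr /= -prodrXr.
  by apply: eq_bigr => d _; case: (eps d).
have det_dimer : \det (\matrix_(i, j) \sum_(d | joins i j d) wt d) =
    \sum_(m | dimer_covering m) \sum_(p : 'S_N * {ffun 'I_N -> G} |
      [forall i, joins i (p.1 i) (p.2 i)] && (p.2 @: 'I_N == m)) (-1) ^+ p.1 * W m.
  rewrite detE (partition_big (fun p : 'S_N * {ffun 'I_N -> G} => p.2 @: 'I_N)
    (fun m => dimer_covering m)) /=.
    by apply: eq_bigr => m _; apply: eq_bigr => p /andP[_ /eqP ->].
  by move=> [s h] /forallP /= /joins_dimer_covering[].
have inner m h s : dimer_covering m -> enumerates f g m h s ->
    \sum_(p : 'S_N * {ffun 'I_N -> G} |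
      [forall i, joins i (p.1 i) (p.2 i)] && (p.2 @: 'I_N == m)) (-1) ^+ p.1 * W m
    = (-1) ^+ s * W m.
  move=> mP E; rewrite (big_pred1 (s, finfun h)) // => -[s' h'] /=.
  apply/andP/eqP => [[/forallP /joins_dimer_covering[_ E'] /eqP hm]|[-> ->]].
    rewrite hm in E'; have [hh <-] := enumerates_uniq mP E E'.
    by congr (_, _); apply/ffunP=> i; rewrite ffunE hh.
  split; first by apply/forallP=> i; rewrite ffunE /joins; have [_ -> ->] := E i; rewrite !eqxx.
  have -> : [ffun i => h i] @: 'I_N = h @: 'I_N by apply: eq_imset => i; rewrite ffunE.
  by rewrite (enumerates_imset mP E).
(* The global sign is read off one reference covering; without any covering both sides are zero. *)
case: (pickP [pred m : {set G} | dimer_covering m]) => [m0 /= m0P|none]; last first.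
  by exists false; rewrite det_dimer /partition_function !big_pred0 ?mulr0.
have [h0 [s0 E0]] := enumerates_exist f_bij g_bij m0P.
exists (odd #|[set d in m0 | eps d]| (+) s0).
rewrite det_dimer big_distrr /=; apply: eq_bigr => m mP.
have [h [s E]] := enumerates_exist f_bij g_bij mP.
rewrite (inner m h s) // WE // mulrA -signr_addb; congr ((-1) ^+ _ * _).
have := kasteleyn_same_sign eps_flip f_bij g_bij sS m0P mP E0 E.
by case: odd; case: odd; case: odd_perm; case: odd_perm.
Qed.

End Determinant.
End Kasteleyn.

(** * Determinants up to sign *)

Definition up_to_sign (K : pzRingType) (x y : K) : Prop :=
  exists b : bool, x = (-1) ^+ b * y.

Lemma up_to_sign_trans (K : pzRingType) (y x z : K) :
  up_to_sign x y -> up_to_sign y z -> up_to_sign x z.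
Proof.
by move=> [b ->] [b' ->]; exists (b (+) b'); rewrite mulrA signr_addb.
Qed.

(* [is_det M z] determines [z] only up to sign. *)
Definition is_det (K : comNzRingType) (A B : finType) (M : A -> B -> K) (z : K) :
    Prop :=
  exists N (f : 'I_N -> A) (g : 'I_N -> B),
    [/\ bijective f, bijective g & z = \det (\matrix_(i, j) M (f i) (g j))].

Lemma is_det_bij (K : comNzRingType) (A A' B B' : finType) (M : A -> B -> K)
    (M' : A' -> B' -> K) (p : A -> A') (q : B -> B') (z : K) :
    bijective p -> bijective q -> (forall a b, M' (p a) (q b) = M a b) ->
  is_det M z -> is_det M' z.
Proof.
move=> p_bij q_bij MM' [N [f [g [f_bij g_bij ->]]]].
exists N, (p \o f), (q \o g); split; [exact: bij_comp | exact: bij_comp |].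
by congr (\det _); apply/matrixP=> i j; rewrite !mxE MM'.
Qed.

Lemma is_det_eq (K : comNzRingType) (A B : finType) (M M' : A -> B -> K) (z : K) :
  (forall a b, M' a b = M a b) -> is_det M z -> is_det M' z.
Proof. by apply: is_det_bij; exists id. Qed.

Definition option_enum (A : Type) N (f : 'I_N -> A) (i : 'I_(1 + N)) : option A :=
  if split i is inr j then Some (f j) else None.

Lemma option_enum_bij (A : finType) N (f : 'I_N -> A) :
  bijective f -> bijective (option_enum f).
Proof.
rewrite /option_enum.
case=> f' fK f'K.
exists (fun o => if o is Some a then rshift 1 (f' a) else lshift N ord0) => [i|[a|]].
- case: splitP => j ij; apply: val_inj; rewrite /= ij ?fK //.
  by rewrite (ord1 j).
- case: splitP => j /= E; first by have := ltn_ord j; rewrite -E.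
  by rewrite -(f'K a); congr (Some (f _)); apply: val_inj; case: E.
- by case: splitP => j //= E.
Qed.

(** The pivot -1 is its own inverse, so the elimination needs no division and the Schur complement
    carries a plus sign. *)
Lemma is_det_schur (K : comNzRingType) (A B : finType)
    (M : option A -> option B -> K) (z : K) :
    M None None = -1 ->
    is_det (fun a b => M (Some a) (Some b) + M (Some a) None * M None (Some b)) z ->
  is_det M (- z).
Proof.
move=> M00 [N [f [g [f_bij g_bij ->]]]].
exists (1 + N)%N, (option_enum f), (option_enum g).
split; [exact: option_enum_bij | exact: option_enum_bij |].
set S := \matrix_(i, j) _.
pose r : 'rV_N := \row_j M None (Some (g j)).
pose c : 'cV_N := \col_i M (Some (f i)) None.
have -> : \matrix_(i, j) M (option_enum f i) (option_enum g j) =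
    block_mx 1%:M 0 (- c) 1%:M *m block_mx (-1)%:M r 0 S.
  rewrite mulmx_block !mul1mx !mul0mx !addr0 mulNmx mul_mx_scalar scaleN1r opprK mulNmx.
  apply/matrixP=> i j; rewrite !mxE /option_enum; case: splitP => i' _; rewrite !mxE;
    case: splitP => j' _; rewrite !mxE.
  - by rewrite M00 (ord1 i') (ord1 j').
  - by [].
  - by [].
  - by rewrite big_ord1 !mxE addrC addrK.
by rewrite det_mulmx det_lblock det_ublock !det1 !mul1r det_scalar1 mulN1r.
Qed.

Lemma prodr_sign (K : comPzRingType) (I : finType) (b : I -> bool) :
  exists b' : bool, \prod_i (-1) ^+ b i = (-1) ^+ b' :> K.
Proof.
exists (odd (\sum_i b i)); rewrite signr_odd.
by rewrite (big_morph _ (exprD (-1)) (expr0 _)).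
Qed.

Lemma det_sign_scale (K : comNzRingType) N (r c : 'I_N -> bool) (A B : 'M[K]_N) :
    (forall i j, A i j = (-1) ^+ r i * (-1) ^+ c j * B i j) ->
  up_to_sign (\det A) (\det B).
Proof.
move=> AB; pose diag (b : 'I_N -> bool) : 'M[K]_N := diag_mx (\row_i (-1) ^+ b i).
have -> : A = diag r *m B *m diag c.
  apply/matrixP=> i j; rewrite AB mul_diag_mx mul_mx_diag !mxE.
  by rewrite mulrAC.
rewrite !det_mulmx !det_diag.
have prod_diag (b : 'I_N -> bool) :
    \prod_i (\row_j (-1) ^+ b j : 'rV[K]_N) 0 i = \prod_i (-1) ^+ b i.
  by apply: eq_bigr => i _; rewrite mxE.
have [b bE] := prodr_sign K r; have [b' bE'] := prodr_sign K c.
exists (b (+) b'); rewrite !prod_diag bE bE'.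
by rewrite mulrAC -signr_addb.
Qed.

(** * The Fox matrix and the twisted graph *)

Section FoxMatrix.
Variables (R : idomainType) (n : nat) (D : knot_diagram) (a0 : face D).
Variables (rho : word a0 -> 'M[R]_n) (rho_rep : representation rho).
Variables (psi : word a0 -> int) (psi_ab : abelianization psi).
Local Notation F := {fraction {poly R}}.
Local Notation t := (laurent_t R).

Definition twist (u : word a0) : 'M[F]_n :=
  t ^ psi u *: map_mx (@laurent_cst R) (rho u).

Lemma laurent_t_neq0 : t != 0.
Proof. by rewrite /laurent_t tofrac_eq0 polyX_eq0. Qed.

Lemma map_laurent_cstM (A B : 'M[R]_n) :
  map_mx (@laurent_cst R) (A *m B) =
  map_mx (@laurent_cst R) A *m map_mx (@laurent_cst R) B.
Proof. exact: (map_mxM (GRing.RMorphism.clone _ _ (@laurent_cst R) (@tofrac _ \o polyC))). Qed.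

Lemma map_laurent_cst1 : map_mx (@laurent_cst R) 1%:M = 1%:M :> 'M_n.
Proof. exact: (map_mx1 (GRing.RMorphism.clone _ _ (@laurent_cst R) (@tofrac _ \o polyC))). Qed.

Lemma twist_cat u v : twist (u ++ v) = twist u *m twist v.
Proof.
case: rho_rep => _ _ rM _; case: psi_ab => pD _ _.
rewrite /twist pD rM map_laurent_cstM expfzDr ?laurent_t_neq0 //.
by rewrite -scalemxAl -scalemxAr scalerA.
Qed.

Lemma psi_nil : psi [::] = 0.
Proof. by case: psi_ab => pD _ _; apply: (addIr (psi [::])); rewrite -pD add0r. Qed.

Lemma twist_nil : twist [::] = 1%:M.
Proof.
by case: rho_rep => _ r1 _ _; rewrite /twist psi_nil r1 expr0z scale1r map_laurent_cst1.
Qed.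

Lemma twist_eq u v : group_eq u v -> twist u = twist v.
Proof.
case: rho_rep => _ _ _ rE; case: psi_ab => _ pE _ uv.
by rewrite /twist (pE _ _ uv) (rE _ _ uv).
Qed.

Definition fox_twist (g : gen a0) (u : word a0) : 'M[F]_n := Phi rho psi (fox g u).

Lemma Phi_prefix x (s : free_ring a0) :
  Phi rho psi [seq (y.1, x :: y.2) | y <- s] = twist [:: x] *m Phi rho psi s.
Proof.
rewrite /Phi big_map mulmx_sumr; apply: eq_bigr => y _ /=.
by rewrite -scalemxAr -[_ *: map_mx _ (rho (x :: _))]/(twist ([:: x] ++ y.2)) twist_cat.
Qed.

Lemma fox_twist_cons g x w : fox_twist g (x :: w) =
  (if x.1 == g then if x.2 then 1%:M else - twist [:: x] else 0) +
  twist [:: x] *m fox_twist g w.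
Proof.
rewrite /fox_twist /= {1}/Phi big_cat /= -!/(Phi rho psi _) Phi_prefix; congr (_ + _).
case: ifP => _; last by rewrite /Phi big_nil.
rewrite /Phi big_seq1; case: ifP => _ /=; last first.
  by rewrite -/(twist [:: x]) mulrN1z scaleN1r.
by rewrite -/(twist [::]) twist_nil mulr1z scale1r.
Qed.

Lemma fox_twist_nil g : fox_twist g [::] = 0.
Proof. by rewrite /fox_twist /Phi big_nil. Qed.

Lemma fox_twist_cat g u v :
  fox_twist g (u ++ v) = fox_twist g u + twist u *m fox_twist g v.
Proof.
elim: u => [|x u IH]; first by rewrite fox_twist_nil twist_nil mul1mx add0r.
by rewrite cat_cons !fox_twist_cons IH mulmxDr addrA mulmxA -twist_cat.
Qed.

Definition at_face (g : gen a0) (A : face D) (X : 'M[F]_n) : 'M[F]_n :=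
  if A == val g then X else 0.

Lemma mul_at_face g A X Y : X *m at_face g A Y = at_face g A (X *m Y).
Proof. by rewrite /at_face; case: ifP; rewrite ?mulmx0. Qed.

(** For the unbounded face the loop is the empty word, and no generator sits there. *)
Lemma fox_twist_loop g A : fox_twist g (loop a0 A) = at_face g A 1%:M.
Proof.
rewrite /loop /at_face; case: insubP => [h _ <-|nA].
  by rewrite fox_twist_cons fox_twist_nil mulmx0 addr0 /= (inj_eq val_inj).
by rewrite fox_twist_nil; case: (A =P val g) nA => // ->; rewrite (valP g).
Qed.

Lemma fox_twist_inv_loop g A : fox_twist g (inv_word (loop a0 A)) =
  at_face g A (- twist (inv_word (loop a0 A))).
Proof.
rewrite /loop /at_face; case: insubP => [h _ <-|nA].
  by rewrite fox_twist_cons fox_twist_nil mulmx0 addr0 /= (inj_eq val_inj).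
by rewrite fox_twist_nil; case: (A =P val g) nA => // ->; rewrite (valP g).
Qed.

(** Product rule. The East term carries minus the image of the whole relator, which is the
    identity. *)
Lemma fox_twist_relator g c : fox_twist g (relator a0 c) =
  at_face g (south c) 1%:M - at_face g (west c) (twist (over_meridian a0 c)) +
  at_face g (north c) (twist (over_meridian a0 c)) - at_face g (east c) 1%:M.
Proof.
have rel1 : twist (relator a0 c) = 1%:M.
  by rewrite -twist_nil; apply/twist_eq/group_relator.
have N A X : at_face g A (- X) = - at_face g A X.
  by rewrite /at_face; case: ifP; rewrite ?oppr0.
rewrite /relator fox_twist_cat [fox_twist g (loop _ _ ++ _)]fox_twist_cat.
rewrite [fox_twist g (over_meridian _ _)]fox_twist_cat !fox_twist_loop !fox_twist_inv_loop.
rewrite mulmxDr !mul_at_face !mulmxN -!twist_cat mulmx1 -/(over_meridian a0 c).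
by rewrite rel1 !N addrA.
Qed.

Lemma psi_inv_loop A : psi (inv_word (loop a0 A)) = - psi (loop a0 A).
Proof.
case: psi_ab => pD pE _; apply/eqP; rewrite -addr_eq0 addrC -pD -psi_nil.
apply/eqP/pE; rewrite /loop; case: insubP => [h _ _|_]; last exact: group_refl.
exact: group_cancel.
Qed.

Lemma psi_crossing d : forth d ->
  psi (loop a0 (lface (flip d))) = psi (loop a0 (lface d)) + 1.
Proof.
case: psi_ab => pD _ /(_ d) + fd; rewrite pD psi_inv_loop => /(_ fd) <-.
by rewrite addrC subrK.
Qed.

Lemma lface_walk (d : D) : lface (walk d) = lface d.
Proof.
have [fK _ tI _] := shadow_spherical D.
apply: val_inj; apply/eqP; rewrite /= eq_sym (left_face_eq fK tI).
exact: fconnect1.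
Qed.

(* A checkerboard colouring of the faces. *)
Definition shade (A : face D) : bool := odd (absz (psi (loop a0 A))).

Lemma odd_abszS (x : int) : odd (absz (x + 1)) = ~~ odd (absz x).
Proof.
case: x => [x|x]; first by rewrite addrC -intS.
have -> : Negz x + 1 = - x%:Z by rewrite NegzE intS opprD addrAC addNr add0r.
by rewrite abszN /= negbK.
Qed.

Lemma shade_flip d : shade (lface (flip d)) = ~~ shade (lface d).
Proof.
rewrite /shade; case: (boolP (forth d)) => [/psi_crossing ->|]; first exact: odd_abszS.
rewrite -forth_flip => /psi_crossing.
have [fK _ _ _] := shadow_spherical D.
by rewrite fK => ->; rewrite odd_abszS negbK.
Qed.

(** The dart separating two consecutive corners has the later one on its left and the earlier one on
    its right. *)
Lemma corner_flip (c : crossing D) i :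
  lface (flip (iter i.+1 turn (val c))) = lface (iter i turn (val c)).
Proof.
have [fK _ tI _] := shadow_spherical D.
by rewrite -lface_walk /= walk_flip_turn.
Qed.

Lemma corner_north (c : crossing D) : lface (flip (val c)) = east c.
Proof.
have [fK _ tI _] := shadow_spherical D.
have /and3P[/eqP o4 _ _] := valP c.
have iter4 := iter_order tI (val c); rewrite o4 in iter4.
by rewrite /east /corner inordK // -(@corner_flip c 3) // iter4.
Qed.

Lemma shade_west c : shade (west c) = ~~ shade (north c).
Proof.
rewrite /west /north /corner !inordK // -[in RHS](@corner_flip c 0) //.
by rewrite shade_flip negbK.
Qed.

Lemma shade_south c : shade (south c) = shade (north c).
Proof.
rewrite /south -[shade (north c)]negbK -shade_west /west /corner !inordK //.
by rewrite -[in RHS](@corner_flip c 1) // shade_flip negbK.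
Qed.

Lemma shade_east c : shade (east c) = ~~ shade (north c).
Proof. by rewrite -corner_north shade_flip /north /corner inordK. Qed.

(** The outgoing dart of the overstrand gives exponent 1 for East relative to North; the relator
    transfers this to South relative to West. *)
Lemma psi_over_meridian c : psi (over_meridian a0 c) = 1.
Proof.
case: psi_ab => pD pE _.
have /and3P[_ _ /psi_crossing] := valP c.
have := pE _ _ (group_relator a0 c).
rewrite psi_nil /relator !pD !psi_inv_loop corner_north.
have -> : lface (val c) = north c by rewrite /north /corner inordK.
lia.
Qed.

(** The Fox signs alternate around the crossing, and so do the colours of the four faces: each sign
    is the colour of the face relative to that of North. *)
Lemma fox_twist_corners (a1 : gen a0) (g : kept_face a0 (val a1)) (g' : gen a0) c p q :
    val g' = val g ->
  fox_twist g' (relator a0 c) p q =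
  (-1) ^+ shade (north c) * (-1) ^+ shade (val g) *
  \sum_(i | corner c i == val g) corner_block rho c i p q.
Proof.
move=> gE; rewrite fox_twist_relator /at_face gE.
have twE : twist (over_meridian a0 c) =
    t *: map_mx (@laurent_cst R) (rho (over_meridian a0 c)).
  by rewrite /twist psi_over_meridian expr1z.
have sum4 (f : 'I_4 -> F) :
    \sum_i f i = f (inord 0) + f (inord 1) + f (inord 2) + f (inord 3).
  rewrite !big_ord_recr big_ord0 /= add0r.
  by do !congr (_ + _); congr f; apply: val_inj; rewrite /= inordK.
rewrite big_mkcond sum4 -!/(north c) -/(west c) -/(south c) -/(east c).
rewrite /corner_block !inordK //= -twE.
have sgn A b (x : F) : shade A = b (+) shade (north c) ->
    (-1) ^+ shade (north c) * (-1) ^+ shade (val g) * (if A == val g then x else 0)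
    = (-1) ^+ b * (if A == val g then x else 0).
  move=> Ab; case: eqP => [<-|_]; last by rewrite !mulr0.
  by rewrite Ab -signr_addb addbCA addbb addbF.
have entry A (X : 'M[F]_n) :
    (if A == val g then X else 0) p q = if A == val g then X p q else 0.
  by case: ifP => // _; rewrite mxE.
rewrite !mulrDr (sgn (north c) false) // (sgn (west c) true) ?shade_west //.
rewrite (sgn (south c) false) ?shade_south // (sgn (east c) true) ?shade_east //.
by rewrite expr0 expr1 !mul1r !mulN1r -!entry !mxE; ring.
Qed.

Definition biadjacency (K : comNzRingType) (G : bigraph K) v y : K :=
  \sum_(e : edge G | (first_end e == v) && (second_end e == y)) weight e.

(** The omitted edges would have weight zero, so they can be put back into the sum. *)
Lemma biadjacency_twisted (a1 : face D) (c : crossing D) p (g : kept_face a0 a1) q :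
  biadjacency (G := twisted_graph a1 rho) (c, p) (g, q) =
  \sum_(i | corner c i == val g) corner_block rho c i p q.
Proof.
rewrite [RHS](bigID (fun i => corner_block rho c i p q != 0)) /= [X in _ + X]big1 ?addr0.
  rewrite (reindex_omap (fun e : twisted_edge a1 rho => (val e).1.1.2)
    (fun i => insub (c, i, g, (p, q)))) /=.
    apply: eq_big => [[[[[c' i] g'] [p' q']] /= e]|[[[[c' i] g'] [p' q']] /= e]].
      apply/andP/andP => [[/eqP[cE pE] /eqP[gE qE]]|[/andP[ci b0] /eqP]].
        subst; split=> //; apply/eqP.
        by rewrite insubT; congr Some; apply: val_inj.
      case: insubP => // x _ xE [xe]; move/eqP: xE; rewrite xe /= !xpair_eqE.
      by case/andP=> /andP[/andP[-> _] ->] /andP[-> ->].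
    by move=> /andP[/eqP[-> ->] /eqP[_ ->]].
  by move=> i iP; rewrite insubT.
by move=> i /andP[_ /negPn/eqP].
Qed.

Variables (k : nat) (cr : 'I_k -> crossing D) (fc : 'I_k.+1 -> gen a0).
Hypotheses (cr_bij : bijective cr) (fc_bij : bijective fc).
Variable j0 : 'I_k.+1.

Lemma kept_face_proof (j : 'I_k) :
  (val (fc (lift j0 j)) != a0) && (val (fc (lift j0 j)) != val (fc j0)).
Proof.
by rewrite (valP (fc _)) (inj_eq val_inj) (inj_eq (bij_inj fc_bij)) eq_sym neq_lift.
Qed.

Definition kept_enum (j : 'I_k) : kept_face a0 (val (fc j0)) :=
  exist _ (val (fc (lift j0 j))) (kept_face_proof j).

Lemma kept_enum_bij : bijective kept_enum.
Proof.
have [fc' fcK fc'K] := fc_bij.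
have inj : injective kept_enum.
  by move=> i j [] /val_inj /(bij_inj fc_bij) /lift_inj.
apply: inj_card_bij => //; rewrite -(card_codom inj); apply: subset_leq_card.
apply/subsetP=> -[A AP] _; have /andP[Aa0 Aj0] := AP.
have : fc' (Sub A Aa0) != j0.
  by apply: contraNneq Aj0 => <-; rewrite fc'K.
rewrite eq_sym => /unlift_some[j jE _]; apply/codomP; exists j.
by apply: val_inj; rewrite /= -jE fc'K.
Qed.

Lemma twisted_alexander_is_det :
  exists2 z, is_det (biadjacency (G := twisted_graph (val (fc j0)) rho)) z &
    up_to_sign z (twisted_alexander rho psi cr fc j0).
Proof.
(* An index of the block matrix decodes into its block and its position inside the block. *)
pose row (s : 'I_(\sum_(i < k) n)) : crossing D * 'I_n :=
  (cr (tagnat.sig1 s), tagnat.sig2 s).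
pose col (s : 'I_(\sum_(i < k) n)) : kept_face a0 (val (fc j0)) * 'I_n :=
  (kept_enum (tagnat.sig1 s), tagnat.sig2 s).
have pair_bij (T : finType) (e : 'I_k -> T) : bijective e ->
    bijective (fun s : 'I_(\sum_(i < k) n) => (e (tagnat.sig1 s), tagnat.sig2 s : 'I_n)).
  case=> e' eK e'K.
  exists (fun x => tagnat.Rank (e' x.1) x.2) => [s|[x y]] /=.
    by rewrite eK tagnat.sig2K.
  by rewrite tagnat.Rank1K tagnat.Rank2K e'K; congr (_, _); apply: val_inj.
exists (\det (\matrix_(i, j) biadjacency (G := twisted_graph (val (fc j0)) rho) (row i) (col j))).
  exists _, row, col; split=> //; apply: pair_bij => //; exact: kept_enum_bij.
rewrite /twisted_alexander.
apply: (det_sign_scale (r := fun i => shade (north (row i).1))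
  (c := fun j => shade (val (col j).1))) => i j.
rewrite !mxE biadjacency_twisted.
rewrite -[Phi _ _ _]/(fox_twist _ _).
rewrite (fox_twist_corners (g := (col j).1)) //.
by rewrite mulrA -signr_addb -signr_addb addbACA addbb addbb mul1r.
Qed.

End FoxMatrix.

(** * Strands, triplings and butterflies *)

(* [e1 e] and [e2 e] are the darts of the edge [e] at its two ends. *)
Record edge_drawing (K : Type) (G : drawing K) (E : finType) (e1 e2 : E -> G) :
    Prop := EdgeDrawing {
  ed_flipK : involutive (@flip G);
  ed_turn_inj : injective (@turn G);
  ed_org_turn : forall d : G, org (turn d) = org d;
  ed_org_connect : forall d d' : G,
    ~~ is_crossing d -> org d = org d' -> fconnect turn d d';
  ed_turn4 : forall d : G, is_crossing d -> turn (turn (turn (turn d))) = d;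
  ed_turn2 : forall d : G, is_crossing d -> turn (turn d) != d;
  ed_fst : forall d : G, is_fst d -> exists e, d = e1 e;
  ed_snd : forall d : G, is_snd d -> exists e, d = e2 e;
  ed_is_fst : forall e, is_fst (e1 e);
  ed_is_snd : forall e, is_snd (e2 e);
  ed_inj : injective e1;
  ed_strand : forall e, on_strand (e1 e) (flip (e2 e)) }.

(** The sum runs over an index type of edges because, in the presence of crossings, the end darts of
    an edge need not be related by [flip]. *)
Definition drawn_adjacency (K : comNzRingType) (G : drawing K) (E : finType)
    (e1 e2 : E -> G) v y : K :=
  \sum_(e | (org (e1 e) == Some (inl v)) && (org (e2 e) == Some (inr y))) wt (e1 e).

Section Classes.
Variables (K : Type) (G : drawing K).
Implicit Types d : G.

Lemma fst_not_crossing d : is_fst d -> ~~ is_crossing d.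
Proof. by rewrite /is_fst /is_crossing; case: org. Qed.

Lemma snd_not_crossing d : is_snd d -> ~~ is_crossing d.
Proof. by rewrite /is_snd /is_crossing; case: org. Qed.

Lemma fst_not_snd d : is_fst d -> ~~ is_snd d.
Proof. by rewrite /is_fst /is_snd; case: org => // -[]. Qed.

Lemma not_crossing d : ~~ is_crossing d -> is_fst d || is_snd d.
Proof. by rewrite /is_fst /is_snd /is_crossing; case: org => // -[]. Qed.

Lemma on_strand_trans d d' d'' : on_strand d d' -> on_strand d' d'' -> on_strand d d''.
Proof. by move=> dd'; elim=> // x _ IH xc; apply: strand_ahead. Qed.

End Classes.

Section Strands.
Variables (K : Type) (G : drawing K) (E : finType) (e1 e2 : E -> G).
Hypothesis ed : edge_drawing e1 e2.
Implicit Types d x z : G.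

Let flipK := ed_flipK ed.
Let flip_inj : injective (@flip G) := inv_inj flipK.

Definition ahead x : G := turn (turn (flip x)).

Lemma ahead_inj : injective ahead.
Proof. by move=> x y /(ed_turn_inj ed)/(ed_turn_inj ed)/flip_inj. Qed.

Lemma org_ahead x : org (ahead x) = org (flip x).
Proof. by rewrite /ahead !(ed_org_turn ed). Qed.

Lemma crossing_ahead x : is_crossing (ahead x) = is_crossing (flip x).
Proof. by rewrite /is_crossing org_ahead. Qed.

Lemma on_strand_iter d x : on_strand d x ->
  exists2 k, x = iter k ahead d & forall l, (l < k)%N -> is_crossing (flip (iter l ahead d)).
Proof.
elim=> [|y _ [k -> kc] yc]; first by exists 0%N.
exists k.+1 => // l; rewrite ltnS leq_eqVlt => /orP[/eqP -> //|]; exact: kc.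
Qed.

(** Going straight on is reversible since two half-turns at a crossing point give the identity. *)
Lemma on_strand_rev d x : on_strand d x -> on_strand (flip x) (flip d).
Proof.
elim=> [|y _ IH yc]; first exact: strand_start.
apply: on_strand_trans IH; rewrite -/(ahead y).
have -> : flip y = ahead (flip (ahead y)).
  by rewrite {1}/ahead flipK /ahead (ed_turn4 ed).
by apply: strand_ahead; rewrite ?flipK ?crossing_ahead //; apply: strand_start.
Qed.

Lemma on_strand_not_crossing d x : on_strand d x -> ~~ is_crossing x -> x = d.
Proof. by case=> // y _ yc; rewrite -/(ahead y) crossing_ahead yc. Qed.

Lemma on_strand_end_uniq x a b : on_strand x a -> on_strand x b ->
  ~~ is_crossing (flip a) -> ~~ is_crossing (flip b) -> a = b.
Proof.
move=> /on_strand_iter[i -> ic] /on_strand_iter[j -> jc] iN jN.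
by case: (ltngtP i j) => [/jc|/ic|-> //]; rewrite ?(negbTE iN) ?(negbTE jN).
Qed.

Lemma on_strand_start_uniq d d' x : on_strand d x -> on_strand d' x ->
  ~~ is_crossing d -> ~~ is_crossing d' -> d = d'.
Proof.
move=> /on_strand_rev dx /on_strand_rev d'x dN d'N.
by apply: flip_inj; apply: (on_strand_end_uniq dx d'x); rewrite flipK.
Qed.

(** By injectivity of [ahead] a repetition can be pulled back to the start [d], which would then
    issue from a crossing point. *)
Lemma iter_ahead_inj d L i j : ~~ is_crossing d ->
    (forall l, (l < L)%N -> is_crossing (flip (iter l ahead d))) ->
    (i <= L)%N -> (j <= L)%N -> iter i ahead d = iter j ahead d ->
  i = j.
Proof.
move=> dN Lc; wlog ij : i j / (i < j)%N.
  by move=> W iL jL ijE; case: (ltngtP i j) => // ij; [|apply: esym]; apply: W.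
move=> _ jL; rewrite -(subnKC (ltnW ij)) iterD => ijE.
have inj_iter n : injective (iter n ahead).
  by elim: n => //= n IH x y /ahead_inj/IH.
move: dN; rewrite (inj_iter _ _ _ ijE) -(subnSK ij) iterS crossing_ahead Lc //.
by apply: leq_trans jL; rewrite ltn_subrL ?(leq_ltn_trans _ ij) // (leq_trans _ ij).
Qed.

Lemma joined_edge d y : is_fst d -> is_snd y -> on_strand d (flip y) ->
  exists2 e, d = e1 e & y = e2 e.
Proof.
move=> /(ed_fst ed)[e de] yS dy; exists e => //; apply: flip_inj.
rewrite de in dy; apply: (on_strand_end_uniq dy (ed_strand ed e)); rewrite flipK.
  exact: snd_not_crossing.
by apply: snd_not_crossing; apply: (ed_is_snd ed).
Qed.

End Strands.
Arguments ahead {K G} x.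

Lemma draws_edge_drawing (K : comNzRingType) (g : bigraph K) (G : drawing K) (z : K) :
    draws G g -> is_det (biadjacency (G := g)) z ->
  exists (E : finType) (e1 e2 : E -> G),
    edge_drawing e1 e2 /\ is_det (drawn_adjacency e1 e2) z.
Proof.
move=> [[[flipK _ turn_inj _] orgE org_conn cross4] _].
move=> [f1 [f2 [fe [f1_bij f2_bij fe_inj [feP feE strandE wtE allE]]]]] gz.
have [e2 e2s e2E] := fin_all_exists2 strandE.
exists (edge g), fe, (fun e => flip (e2 e)).
have org_turn (d : G) : org (turn d) = org d.
  by rewrite (orgE d (turn d)) // fconnect1.
have fe_fst e : is_fst (fe e) by apply/feP; exists e.
split; last first.
  apply: (is_det_bij f1_bij f2_bij _ gz) => a b; rewrite /drawn_adjacency /biadjacency.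
  apply: eq_big => [e|e _]; last exact: wtE.
  rewrite feE e2E; congr (_ && _).
    by apply/eqP/eqP => [[/(bij_inj f1_bij)]|->].
  by apply/eqP/eqP => [[/(bij_inj f2_bij)]|->].
have iter4 (d : G) : is_crossing d -> turn (turn (turn (turn d))) = d.
  by move=> /cross4 o4; have := iter_order turn_inj d; rewrite o4.
split=> //.
- move=> d /cross4 o4; apply/eqP => d2.
  have : (fingraph.order turn d <= 2)%N.
    rewrite -(size_orbit turn d) -(size_traject turn d 2).
    apply: uniq_leq_size (orbit_uniq _ _) _ => x; rewrite -fconnect_orbit.
    move=> /iter_findex <-; elim: findex => [|m]; first by rewrite /= inE eqxx.
    by rewrite !inE iterS => /orP[]/eqP->; rewrite ?d2 eqxx ?orbT.
  by rewrite o4.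
- by move=> d /feP.
(* Either orientation of [d] may lie on a strand. If [d] itself does, it must be the start, which is
   in the first class; so [flip d] does, and it is the end of the strand. *)
- move=> d dS; have dN := snd_not_crossing dS.
  have startE e x : on_strand (fe e) x -> ~~ is_crossing x -> x = fe e.
    case=> // y _ yc; rewrite /is_crossing !org_turn.
    by move: yc; rewrite /is_crossing; case: org.
  have [e [/startE/(_ dN) de|ed]] := allE d.
    by move: (fe_fst e); rewrite -de => /fst_not_snd; rewrite dS.
  exists e; apply: (can_inj flipK); rewrite flipK.
  have iterE x : on_strand (fe e) x -> exists2 k, x = iter k ahead (fe e) &
      forall l, (l < k)%N -> is_crossing (flip (iter l ahead (fe e))).
    elim=> [|y _ [k -> kc] yc]; first by exists 0%N.
    by exists k.+1 => // l; rewrite ltnS leq_eqVlt => /orP[/eqP -> //|]; apply: kc.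
  have [i iE ic] := iterE _ ed; have [j jE jc] := iterE _ (e2s e).
  have iN : ~~ is_crossing (flip (flip d)) by rewrite flipK.
  have jN : ~~ is_crossing (flip (e2 e)) by rewrite /is_crossing e2E.
  rewrite iE in iN; rewrite jE in jN.
  rewrite iE jE.
  by case: (ltngtP i j) => [/jc|/ic|-> //]; rewrite ?(negbTE iN) ?(negbTE jN).
- by move=> e; rewrite /is_snd e2E.
- by move=> e; rewrite flipK.
Qed.

(** Without crossings a strand is a single dart, so the end darts of an edge are exchanged by
    [flip]. *)
Lemma uncrossed_bipartite_map (K : comNzRingType) (G : drawing K) (E : finType)
    (e1 e2 : E -> G) :
    edge_drawing e1 e2 -> uncrossed G ->
  bipartite_map G /\ forall v y, drawn_adjacency e1 e2 v y =
    \sum_(d | (org d == Some (inl v)) && (org (flip d) == Some (inr y))) wt d.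
Proof.
move=> ed un; have flipK := ed_flipK ed.
have e12 e : flip (e1 e) = e2 e.
  apply: (inv_inj flipK); rewrite flipK.
  by have [|y _ yc] := ed_strand ed e; last by have := un (flip y); rewrite yc.
split.
  split=> //; [exact: (ed_turn_inj ed)|exact: (ed_org_turn ed)| |].
    by move=> d d'; apply: (ed_org_connect ed).
  move=> d; case: (boolP (is_fst d)) => [/(ed_fst ed)[e ->]|dN].
    rewrite e12; apply/negbTE; apply: contraL (ed_is_snd ed e).
    exact: fst_not_snd.
  have := not_crossing (un d); rewrite (negbTE dN) => /(ed_snd ed)[e ->].
  by rewrite -e12 flipK; apply: (ed_is_fst ed).
move=> v y; rewrite /drawn_adjacency.
pose P d := (org d == Some (inl v)) && (org (flip d) == Some (inr y)).
rewrite -/(index_enum _) [RHS](eq_bigl (mem (e1 @: [set e | P (e1 e)]))).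
  rewrite big_imset /=; last by move=> ? ? _ _; apply: (ed_inj ed).
  by apply: eq_bigl => e; rewrite inE /P e12.
move=> d; rewrite -/(P d); apply/idP/imsetP => [dP|[e + ->]]; last by rewrite inE.
have [e de] : exists e, d = e1 e.
  by apply: (ed_fst ed); case/andP: dP => /eqP dv _; rewrite /is_fst dv.
by exists e => //; rewrite inE -de.
Qed.

Lemma weaken_inl (A B : eqType) (o : option (A + B)) a :
  (weaken o == Some (inl (Some a))) = (o == Some (inl a)).
Proof. by case: o => [[x|x]|]. Qed.

Lemma weaken_inr (A B : eqType) (o : option (A + B)) b :
  (weaken o == Some (inr (Some b))) = (o == Some (inr b)).
Proof. by case: o => [[x|x]|]. Qed.

Lemma weaken_None (A B : eqType) (o : option (A + B)) :
  (weaken o == Some (inl None)) = false /\ (weaken o == Some (inr None)) = false.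
Proof. by case: o => [[x|x]|]. Qed.

Lemma weaken_inj (A B : eqType) : injective (@weaken A B).
Proof. by move=> [[x|x]|] [[y|y]|] // [->]. Qed.

(** * Effect of a tripling on strands and on the adjacency matrix *)

Section Tripling.
Variables (K : comNzRingType) (G : drawing K) (E : finType) (e1 e2 : E -> G).
Hypothesis ed : edge_drawing e1 e2.
Variables (s1 s2 dv : G) (s_ok : triple_ok s1 s2 dv).
Local Notation H := (triple s1 s2 dv).

Let flipK := ed_flipK ed.
Let flip_inj : injective (@flip G) := inv_inj flipK.

(** The darts whose [flip] is changed by the tripling. *)
Let cut := [:: s1; s2; flip s1; flip s2].

Lemma cut_flip x : (flip x \in cut) = (x \in cut).
Proof.
rewrite !inE !(inj_eq flip_inj) !(canF_eq flipK).
by do 4 case: (x == _).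
Qed.

Lemma triple_edge : exists e0, [/\ dv = e1 e0, on_strand (e2 e0) s1,
  on_strand s1 s2 & on_strand s2 (flip dv)].
Proof.
case: s_ok => [[dy dyS dy1]] [s12 s2v dvF].
have : on_strand dv (flip dy).
  rewrite -[dv]flipK; apply: (on_strand_rev ed).
  exact: on_strand_trans dy1 (on_strand_trans s12 s2v).
by case/(joined_edge ed dvF dyS) => e0 vE yE; exists e0; rewrite -yE.
Qed.

Lemma cut_strand x : x \in cut -> on_strand dv x \/ exists2 y, is_snd y & on_strand y x.
Proof.
case: s_ok => [[dy dyS dy1]] [s12 s2v dvF].
have dy2 := on_strand_trans dy1 s12.
have dv2 : on_strand dv (flip s2) by rewrite -[dv]flipK; apply: (on_strand_rev ed).
have dv1 := on_strand_trans dv2 (on_strand_rev ed s12).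
by rewrite !inE => /or4P[] /eqP->; [right; exists dy|right; exists dy|left|left].
Qed.

Lemma triple_flip_out x : x \notin cut -> flip (inl x : H) = inl (flip x).
Proof.
rewrite !inE !negb_or => /and4P[/negbTE a /negbTE b /negbTE c /negbTE d].
by rewrite /flip /= a b c d.
Qed.

Lemma triple_turn2 x : turn (turn (inl x : H)) = inl (turn (turn x)).
Proof. by []. Qed.

Lemma triple_crossing x : is_crossing (inl x : H) = is_crossing x.
Proof. by rewrite /is_crossing /=; case: org => [[]|]. Qed.

Lemma triple_on_strand (z : G) k :
    (forall l, (l < k)%N -> is_crossing (flip (iter l ahead z))) ->
    (forall l, (l < k)%N -> iter l ahead z \notin cut) ->
  on_strand (inl z : H) (inl (iter k ahead z)).
Proof.
elim: k => [|k IH] kc kout; first exact: strand_start.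
have IHk : on_strand (inl z : H) (inl (iter k ahead z)).
  by apply: IH => l lk; [apply: kc | apply: kout]; apply: ltnW.
have fE := triple_flip_out (kout k (leqnn _)).
rewrite iterS /ahead -triple_turn2 -fE; apply: strand_ahead => //.
by rewrite fE triple_crossing kc.
Qed.

(** Every cut dart lies on the strand from [v] or on that from [y], and a strand determines its
    start. *)
Lemma other_strand e e0 : dv = e1 e0 -> e != e0 ->
  on_strand (inl (e1 e) : H) (flip (inl (e2 e) : H)).
Proof.
move=> dvE ee0.
have out x : on_strand (e1 e) x -> x \notin cut.
  move=> ex; apply/negP=> /cut_strand[dvx|[y yS yx]].
    case/eqP: ee0; apply: (ed_inj ed); rewrite -dvE.
    apply: (on_strand_start_uniq ed ex dvx); apply: fst_not_crossing.
      exact: (ed_is_fst ed).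
    by rewrite dvE; apply: (ed_is_fst ed).
  have : y = e1 e.
    apply: (on_strand_start_uniq ed yx ex); first exact: snd_not_crossing.
    by apply: fst_not_crossing; apply: (ed_is_fst ed).
  by move=> yE; have := fst_not_snd (ed_is_fst ed e); rewrite -yE yS.
have eS := ed_strand ed e.
rewrite triple_flip_out; last by rewrite -cut_flip out.
have [k kE kc] := on_strand_iter eS.
rewrite kE; apply: triple_on_strand => // l lk; apply: out.
elim: l lk => [|l IH] lk; first exact: strand_start.
apply: strand_ahead; last by apply: kc; apply: ltnW.
by apply: IH; apply: ltnW.
Qed.

(* Along the strand from [z] to [z'], the cut darts are met only at the positions
   [i] and [j] of [a] and [b]. *)
Lemma cut_position (z z' : G) L i j a b l :
    ~~ is_crossing z -> ~~ is_crossing z' -> z != z' ->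
    (forall l, (l < L)%N -> is_crossing (flip (iter l ahead z))) ->
    flip z' = iter L ahead z ->
    a = iter i ahead z -> b = iter j ahead z -> (i <= L)%N -> (j <= L)%N ->
    (l <= L)%N -> iter l ahead z \in [:: a; b; flip a; flip b] ->
  (l == i) || (l == j).
Proof.
move=> zN z'N zz' Lc z'E aE bE iL jL lL.
have strand m m' : (m <= m' <= L)%N -> on_strand (iter m ahead z) (iter m' ahead z).
  case/andP=> mm'; rewrite -(subnK mm'); elim: (m' - m)%N => [|n IH] nL.
    exact: strand_start.
  by apply: strand_ahead; [apply/IH/ltnW | apply: Lc].
have no_flip m : (m <= L)%N -> iter l ahead z != flip (iter m ahead z).
  move=> mL; apply/eqP=> lm; case/eqP: zz'.
  apply: (on_strand_start_uniq ed (x := iter l ahead z)) => //.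
    by apply: (strand 0%N); rewrite lL.
  rewrite lm -[z']flipK z'E; apply: (on_strand_rev ed).
  by apply: strand; rewrite mL leqnn.
rewrite !inE aE bE (negbTE (no_flip _ iL)) (negbTE (no_flip _ jL)) !orbF.
by case/orP=> /eqP lE; apply/orP; [left|right]; apply/eqP;
  apply: (iter_ahead_inj ed zN Lc lL _ lE).
Qed.

Lemma cut_strands e0 : dv = e1 e0 -> on_strand (e2 e0) s1 -> on_strand s1 s2 ->
    on_strand s2 (flip dv) ->
  [/\ on_strand (inl dv : H) (flip (inr WV : H)),
      on_strand (inr UW : H) (flip (inr WU : H)) &
      on_strand (inr UY : H) (flip (inl (e2 e0) : H))].
Proof.
move=> dvE y1 s12 s2v; set dy := e2 e0 in y1 *.
have dvN : ~~ is_crossing dv.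
  by rewrite dvE; apply: fst_not_crossing; apply: (ed_is_fst ed).
have dyN : ~~ is_crossing dy by apply: snd_not_crossing; apply: (ed_is_snd ed).
have dvy : dv != dy.
  by apply/eqP=> vy; have := fst_not_snd (ed_is_fst ed e0); rewrite -dvE vy (ed_is_snd ed).
have cutE x : (x \in [:: flip s2; flip s1; flip (flip s2); flip (flip s1)]) = (x \in cut).
  rewrite !flipK !inE; case: (x == s1); case: (x == s2); case: (x == flip s1);
  by rewrite ?orbT ?orbF.
have cutE' x : (x \in [:: s1; s2; flip s1; flip s2]) = (x \in cut) by [].
have v2 : on_strand dv (flip s2) by rewrite -[dv]flipK; apply: (on_strand_rev ed).
have v21 := on_strand_rev ed s12.
have v1y := on_strand_rev ed y1.
(* Positions along the strand from [v]: [flip s2] at i, [flip s1] at p + i, the dart entering [y] at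
   q + p + i. In the opposite direction, [dy_strand] places [s1] at k1 and [s2] at k2 + k1. *)
have [i iE ic] := on_strand_iter v2.
have [p pE pc] := on_strand_iter v21.
have [q qE qc] := on_strand_iter v1y.
rewrite iE -iterD in pE; rewrite pE -iterD in qE.
have Lc l : (l < q + (p + i))%N -> is_crossing (flip (iter l ahead dv)).
  case: (ltnP l (p + i)) => [|pl].
    case: (ltnP l i) => [/ic //|il].
    by rewrite -(subnK il) ltn_add2r => /pc; rewrite iE -iterD.
  by rewrite -(subnK pl) ltn_add2r => /qc; rewrite pE -iterD.
have vpos l : (l <= q + (p + i))%N -> iter l ahead dv \in cut -> (l == i) || (l == (p + i)%N).
  move=> lL; rewrite -cutE; apply: (cut_position dvN dyN dvy Lc qE iE pE) => //.
    by rewrite addnA leq_addl.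
  by rewrite leq_addl.
have dy_strand : exists k1 k2 L', [/\ s1 = iter k1 ahead dy, s2 = iter (k2 + k1) ahead dy,
    (k2 + k1 <= L')%N, flip dv = iter L' ahead dy &
    forall l, (l < L')%N -> is_crossing (flip (iter l ahead dy))].
  have [k1 k1E k1c] := on_strand_iter y1.
  have [k2 k2E k2c] := on_strand_iter s12.
  have [k3 k3E k3c] := on_strand_iter s2v.
  rewrite k1E -iterD in k2E; rewrite k2E -iterD in k3E.
  exists k1, k2, (k3 + (k2 + k1))%N; split=> //; first by rewrite leq_addl.
  move=> l; case: (ltnP l (k2 + k1)) => [|pl].
    case: (ltnP l k1) => [/k1c //|il].
    by rewrite -(subnK il) ltn_add2r => /k2c + _; rewrite k1E -iterD.
  by rewrite -(subnK pl) ltn_add2r => /k3c; rewrite k2E -iterD.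
split.
- rewrite [flip _]/= iE; apply: triple_on_strand => // l li.
  have lL : (l <= q + (p + i))%N by rewrite addnA (leq_trans (ltnW li)) ?leq_addl.
  apply/negP=> /(vpos l lL); rewrite !ltn_eqF //.
  by apply: leq_trans li _; rewrite leq_addl.
- have [k1 [k2 [L' [k1E k2E kL L'E L'c]]]] := dy_strand.
  have ypos l : (l <= L')%N -> iter l ahead dy \in cut -> (l == k1) || (l == (k2 + k1)%N).
    move=> lL; rewrite -cutE'; apply: (cut_position dyN dvN _ L'c L'E k1E k2E) => //.
      by rewrite eq_sym.
    by apply: leq_trans kL; rewrite leq_addl.
  (* If u and w subdivide the same segment they are directly joined; otherwise the new edge passes
     through the crossing points between [s1] and [s2]. *)
  rewrite [flip _]/=; case: (eqVneq s1 s2) => s12E; first exact: strand_start.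
  have k2_gt0 : (0 < k2)%N.
    by case: (k2) k2E => // /esym; rewrite add0n -k1E => /eqP; rewrite (negbTE s12E).
  have UWf : flip (inr UW : H) = inl (flip s1) by rewrite /flip /= (negbTE s12E).
  have k1c : is_crossing (flip s1).
    by rewrite k1E; apply: L'c; apply: leq_trans kL; rewrite -[ltnLHS]add0n ltn_add2r.
  have first : on_strand (inr UW : H) (inl (ahead s1)).
    have -> : inl (ahead s1) = turn (turn (flip (inr UW : H))) by rewrite UWf.
    apply: strand_ahead; first exact: strand_start.
    by rewrite UWf triple_crossing.
  apply: on_strand_trans first _.
  have kk : (k2 + k1)%N = (k2.-1 + k1.+1)%N by rewrite addnS -addSn prednK.
  have a1E : ahead s1 = iter k1.+1 ahead dy by rewrite iterS -k1E.
  have s2E : iter k2.-1 ahead (ahead s1) = s2 by rewrite a1E -iterD -kk -k2E.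
  have lE l : iter l ahead (ahead s1) = iter (l + k1.+1) ahead dy by rewrite a1E -iterD.
  have := @triple_on_strand (ahead s1) k2.-1; rewrite s2E; apply=> l lk; rewrite lE.
    by apply: L'c; apply: leq_trans kL; rewrite kk ltn_add2r.
  apply/negP=> lcut; have lL : (l + k1.+1 <= L')%N.
    by apply: leq_trans kL; rewrite kk leq_add2r ltnW.
  have /orP[] := ypos _ lL lcut; first by rewrite gtn_eqF // addnS ltnS leq_addl.
  by rewrite kk eqn_add2r ltn_eqF.
- case: (eqVneq dy s1) => yE; first by rewrite /= yE eqxx; apply: strand_start.
  have q_gt0 : (0 < q)%N.
    case: (q) qE => // /esym; rewrite add0n -pE => /flip_inj ys.
    by rewrite ys eqxx in yE.
  have dy_out : dy \notin cut.
    rewrite -cut_flip qE; apply/negP=> /(vpos _ (leqnn _)).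
    by move=> /orP[]/eqP; lia.
  rewrite triple_flip_out //.
  have s1c : is_crossing s1 by rewrite -[s1]flipK pE Lc //; lia.
  have first : on_strand (inr UY : H) (inl (ahead (flip s1))).
    have -> : inl (ahead (flip s1)) = turn (turn (flip (inr UY : H))).
      by rewrite /ahead flipK.
    apply: strand_ahead; first exact: strand_start.
    by rewrite [flip _]/= triple_crossing.
  apply: on_strand_trans first _.
  have qq : (q + (p + i))%N = (q.-1 + (p + i).+1)%N by rewrite addnS -addSn prednK.
  have a1E : ahead (flip s1) = iter (p + i).+1 ahead dv by rewrite iterS -pE.
  have lE l : iter l ahead (ahead (flip s1)) = iter (l + (p + i).+1) ahead dv.
    by rewrite a1E -iterD.
  have := @triple_on_strand (ahead (flip s1)) q.-1; rewrite lE -qq -qE.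
  apply=> l lk; rewrite lE.
    by apply: Lc; rewrite qq ltn_add2r.
  apply/negP=> lcut; have lL : (l + (p + i).+1 <= q + (p + i))%N.
    by rewrite qq leq_add2r ltnW.
  have /orP[] := vpos _ lL lcut; rewrite gtn_eqF // addnS ltnS ?leq_addl //.
  by rewrite addnA leq_addl.
Qed.

(** The tripled edge keeps its index and its dart at v, becoming wv; [true] stands for uy and
    [false] for uw. *)
Definition triple_fst (e : E + bool) : H :=
  match e with inl e => inl (e1 e) | inr true => inr UY | inr false => inr UW end.

Definition triple_snd (e0 : E) (e : E + bool) : H :=
  match e with
  | inl e => if e == e0 then inr WV else inl (e2 e)
  | inr true => inl (e2 e0)
  | inr false => inr WU
  end.

(** A coincidence would put one dart on the strands from both ends, which would then start at the
    same dart although their classes differ. *)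
Lemma cut_not_flip : [/\ s1 != flip s1, s1 != flip s2, s2 != flip s1 & s2 != flip s2].
Proof.
case: s_ok => [[dy dyS dy1]] [s12 s2v dvF].
have dy2 := on_strand_trans dy1 s12.
have dv2 : on_strand dv (flip s2) by rewrite -[dv]flipK; apply: (on_strand_rev ed).
have dv1 := on_strand_trans dv2 (on_strand_rev ed s12).
have no x : on_strand dy x -> on_strand dv x -> False.
  move=> dyx dvx; have := fst_not_snd dvF.
  have -> : dv = dy.
    by apply: (on_strand_start_uniq ed dvx dyx);
      [apply: fst_not_crossing | apply: snd_not_crossing].
  by rewrite dyS.
by split; apply/eqP=> sE; [apply: (no s1)|apply: (no s1)|apply: (no s2)|apply: (no s2)];
  rewrite // {1}sE.
Qed.

Lemma triple_flipK : involutive (@flip H).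
Proof.
have [n11 n12 n21 n22] := cut_not_flip.
have f11 : flip s1 != s1 by rewrite eq_sym.
have f12 : flip s2 != s1 by rewrite eq_sym.
have f21 : flip s1 != s2 by rewrite eq_sym.
have f22 : flip s2 != s2 by rewrite eq_sym.
case=> [x|[]].
- case: (boolP (x \in cut)) => [|xc]; last by rewrite !triple_flip_out ?cut_flip ?flipK.
  rewrite !inE => /or4P[]/eqP-> /=; rewrite /flip /= ?eqxx ?(negbTE n11) ?(negbTE n12)
    ?(negbTE n21) ?(negbTE n22) ?(negbTE f11) ?(negbTE f12) ?(negbTE f21) ?(negbTE f22) //=.
  + by case: (eqVneq s2 s1) => [-> //|s21]; rewrite /= eq_sym (negbTE s21).
  + by rewrite (inj_eq flip_inj); case: (eqVneq s1 s2) => [-> //|s21] /=; rewrite (negbTE s21).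
- by rewrite /flip /= eqxx.
- rewrite /flip /=; case: (eqVneq s1 s2) => [s12|s12] /=; first by rewrite s12 eqxx.
  by rewrite (negbTE f11) (inj_eq flip_inj) (negbTE s12) eqxx.
- rewrite /flip /=; case: (eqVneq s1 s2) => [s12|s12] /=; first by rewrite s12 eqxx.
  by rewrite eq_sym (negbTE s12) (negbTE n22) (negbTE n21) eqxx.
- by rewrite /flip /= (negbTE f12) eqxx.
Qed.

Lemma triple_edge_drawing e0 : dv = e1 e0 -> on_strand (e2 e0) s1 ->
    on_strand s1 s2 -> on_strand s2 (flip dv) ->
  edge_drawing triple_fst (triple_snd e0).
Proof.
move=> dvE y1 s12 s2v; have [sWV sUW sUY] := cut_strands dvE y1 s12 s2v.
have cross x : is_crossing (inl x : H) = is_crossing x := triple_crossing x.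
have fstE x : is_fst (inl x : H) = is_fst x by rewrite /is_fst /=; case: org => [[]|].
have sndE x : is_snd (inl x : H) = is_snd x by rewrite /is_snd /=; case: org => [[]|].
split.
- exact: triple_flipK.
- by case=> [x|[]] [y|[]] //= [] /(ed_turn_inj ed) ->.
- by case=> [x|[]] //=; rewrite /turn /= (ed_org_turn ed).
- case=> [x|x] [y|y]; rewrite ?cross => xN xy.
  + have := ed_org_connect ed xN (weaken_inj xy) => /iter_findex <-.
    elim: findex => [|n IH]; first exact: connect0.
    exact: connect_trans IH (fconnect1 (@turn H) (inl _)).
  + by move: xy; case: y => /=; case: (org x) => [[]|].
  + by move: xy; case: x {xN} => /=; case: (org y) => [[]|].
  + by case: x xy {xN}; case: y => //= _;
      first [exact: connect0 | exact: (fconnect1 (@turn H))].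
- by case=> [x|[]] //; rewrite cross => /(ed_turn4 ed) xE; rewrite /turn /= xE.
- case=> [x|[]] //; rewrite cross => /(ed_turn2 ed); apply: contraNneq.
  by case=> xE; apply/eqP.
- case=> [x|[]] //;
    [rewrite fstE | by move=> _; exists (inr true) | by move=> _; exists (inr false)].
  by move/(ed_fst ed) => [e ->]; exists (inl e).
- case=> [x|[]] //; [rewrite sndE | by move=> _; exists (inr false) | ].
    move/(ed_snd ed) => [e ->]; case: (eqVneq e e0) => [->|ne]; first by exists (inr true).
    by exists (inl e); rewrite /= (negbTE ne).
  by move=> _; exists (inl e0); rewrite /= eqxx.
- by case=> [e|[]] //=; rewrite fstE; apply: (ed_is_fst ed).
- case=> [e|[]] //=; last by rewrite sndE; apply: (ed_is_snd ed).
  by case: ifP => // _; rewrite sndE; apply: (ed_is_snd ed).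
- by case=> [e|[]] [e'|[]] //= [] /(ed_inj ed) ->.
- case=> [e|[]] //; rewrite [triple_fst _]/= [triple_snd _ _]/=.
  by case: eqP => [->|/eqP/(other_strand dvE)//]; rewrite -dvE.
Qed.

(** The lost entry of the tripled edge returns as the product of the weights 1 of wv and [wt dv] of
    uy. *)
Lemma triple_adjacency e0 : dv = e1 e0 ->
  let M := drawn_adjacency triple_fst (triple_snd e0) in
  M None None = -1 /\ forall v y,
  M (Some v) (Some y) + M (Some v) None * M None (Some y) = drawn_adjacency e1 e2 v y.
Proof.
move=> dvE M.
have ME v y : M v y =
    (if (weaken (org dv) == Some (inl v)) && (y == None) then 1 else 0)
  + (\sum_(e | e != e0)
      if (weaken (org (e1 e)) == Some (inl v)) && (weaken (org (e2 e)) == Some (inr y))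
      then wt (e1 e) else 0)
  + ((if (v == None) && (weaken (org (e2 e0)) == Some (inr y)) then wt dv else 0)
  + (if (v == None) && (y == None) then -1 else 0)).
  have eqN (A : eqType) (o : option A) : (None == o) = (o == None) by rewrite eq_sym.
  have inlN (A B : eqType) (o : option A) :
    (Some (inl None) == Some (inl o) :> option (option A + B)) = (o == None) by case: o.
  have inrN (A B : eqType) (o : option B) :
    (Some (inr None) == Some (inr o) :> option (A + option B)) = (o == None) by case: o.
  rewrite /M /drawn_adjacency big_mkcond big_sumType big_bool /= (bigD1 e0) //= eqxx.
  rewrite -dvE eqxx !inlN !inrN; congr (_ + _ + _).
  apply: eq_bigr => e ne; rewrite (negbTE ne) dvE (inj_eq (ed_inj ed)) (negbTE ne).
  by [].
split.
  rewrite ME (weaken_None _).1 /= (weaken_None _).2 big1 ?add0r //= => e _.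
  by rewrite (weaken_None _).1.
move=> v y.
have -> : M (Some v) None = if org dv == Some (inl v) then 1 else 0.
  rewrite ME big1 => [|e _]; last by rewrite (weaken_None _).2 andbF.
  by rewrite weaken_inl andbT !addr0.
have -> : M None (Some y) = if org (e2 e0) == Some (inr y) then wt dv else 0.
  rewrite ME big1 => [|e _]; last by rewrite (weaken_None _).1.
  by rewrite weaken_inr andbF !addr0 add0r.
rewrite ME andbF /= add0r !addr0.
rewrite [RHS]big_mkcond [RHS](bigD1 e0) //= -dvE addrC; congr (_ + _).
  by apply: eq_bigr => e _; rewrite weaken_inl weaken_inr.
by case: (org dv == _); case: (org (e2 e0) == _); rewrite ?mul1r ?mul0r.
Qed.

Lemma triple_preserves z : is_det (drawn_adjacency e1 e2) z ->
  exists (E' : finType) (e1' e2' : E' -> H),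
    edge_drawing e1' e2' /\ is_det (drawn_adjacency e1' e2') (- z).
Proof.
move=> Gz; have [e0 [dvE y1 s12 s2v]] := triple_edge.
exists (E + bool)%type, triple_fst, (triple_snd e0).
split; first exact: triple_edge_drawing.
have [M00 Ms] := triple_adjacency dvE.
by apply: is_det_schur => //; apply: is_det_eq Gz => v y; apply: Ms.
Qed.

End Tripling.

(** For the butterfly, listing preimages under [turn] is easier than comparing its many cases
    pairwise. *)
Lemma surjective_inj (T : finType) (f : T -> T) :
  (forall y, exists x, f x = y) -> injective f.
Proof.
move=> f_surj; have [g gK] := fin_all_exists f_surj.
have [h hK Kh] := injF_bij (can_inj gK).
by apply: (can_inj (g := g)) => x; rewrite -[x]Kh gK.
Qed.

(** * Effect of a butterfly on strands and on the adjacency matrix *)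

Section Butterflies.
Variables (K : comNzRingType) (G : drawing K) (E : finType) (e1 e2 : E -> G).
Hypothesis ed : edge_drawing e1 e2.
Variables (c : G) (sw : bool) (c_ok : butterfly_ok c).
Local Notation H := (butterfly c sw).

Let flipK := ed_flipK ed.
Let flip_inj : injective (@flip G) := inv_inj flipK.
Let turn_inj := ed_turn_inj ed.

Local Notation cq := (turn c).
Local Notation cq' := (turn (turn c)).
Local Notation cp' := (turn (turn (turn c))).
Local Notation dp := (flip c).
Local Notation dq := (flip cq).
Local Notation dq' := (flip cq').
Local Notation dp' := (flip cp').

Let corners := [:: c; cq; cq'; cp'].

Definition before d : H :=
  if d == dp then inr B_pq else if d == dq' then inr B_qp' else inl d.

Lemma butterfly_turnE d : turn (inl d : H) =
  if d == c then inr B_wu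
  else if d == cp' then inl c
  else if d == cq then inl cq'
  else if d == cq' then inr B_uw
  else if d == dq then inr B_qp
  else if d == dp' then inr B_pq'
  else before (turn d).
Proof. by []. Qed.

Lemma corner_facts : [/\ is_crossing c, turn cp' = c,
  [/\ c != cq, c != cq' & c != cp'] & [/\ cq != cq', cq != cp' & cq' != cp']].
Proof.
case: c_ok => cN _; have c4 := ed_turn4 ed cN; have c2 := ed_turn2 ed cN.
have n1 : c != cq by apply: contraNneq c2 => cE; rewrite -cE -cE eqxx.
have n3 : c != cp'.
  by apply/eqP=> cE; move: n1; rewrite -{1}c4 -cE eqxx.
have n2 : c != cq' by rewrite eq_sym.
by split=> //; split; rewrite ?(inj_eq turn_inj).
Qed.

Lemma corner_crossing d : d \in corners -> is_crossing d.
Proof.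
have [cN _ _ _] := corner_facts.
by rewrite !inE => /or4P[] /eqP->; rewrite /is_crossing ?(ed_org_turn ed).
Qed.

Lemma corner_turn d : (turn d \in corners) = (d \in corners).
Proof.
have [_ c4 _ _] := corner_facts; rewrite !inE !(inj_eq turn_inj).
rewrite -[in turn d == c]c4 (inj_eq turn_inj).
by case: (d == c); case: (d == cq); case: (d == cq'); case: (d == cp').
Qed.

Lemma not_crossing_corner d : ~~ is_crossing d -> d \notin corners.
Proof. by apply: contraNN; apply: corner_crossing. Qed.

Lemma end_facts : [/\ is_fst dp, is_snd dq, is_snd dq' & is_fst dp'].
Proof. by case: c_ok. Qed.

Lemma end_out : [/\ dp \notin corners, dq \notin corners, dq' \notin corners &
  dp' \notin corners].
Proof.
have [p q q' p'] := end_facts.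
split; apply: not_crossing_corner;
  first [exact: fst_not_crossing | exact: snd_not_crossing].
Qed.

Lemma fst_snd_neq (d d' : G) : is_fst d -> is_snd d' -> (d == d') = false /\ (d' == d) = false.
Proof.
move=> df dS; have dN := fst_not_snd df.
by split; apply/eqP=> de; move: dN; rewrite ?de ?dS // -de dS.
Qed.

Lemma butterfly_turn_out d : d \notin corners ->
  turn (inl d : H) =
  if d == dq then inr B_qp else if d == dp' then inr B_pq' else before (turn d).
Proof.
rewrite !inE !negb_or butterfly_turnE => /and4P[].
by move=> /negbTE-> /negbTE-> /negbTE-> /negbTE->.
Qed.

Lemma butterfly_turn_corner : [/\ turn (inl c : H) = inr B_wu,
  turn (inl cp' : H) = inl c, turn (inl cq : H) = inl cq' &
  turn (inl cq' : H) = inr B_uw].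
Proof.
have [_ _ [n1 n2 n3] [n4 n5 n6]] := corner_facts.
split; rewrite butterfly_turnE.
- by rewrite eqxx.
- by rewrite [cp' == c]eq_sym (negbTE n3) eqxx.
- by rewrite [cq == c]eq_sym (negbTE n1) (negbTE n5) eqxx.
- by rewrite [cq' == c]eq_sym (negbTE n2) (negbTE n6) [cq' == cq]eq_sym (negbTE n4) eqxx.
Qed.

Lemma butterfly_turn_before d : d \notin corners -> exists x : H, turn x = before d.
Proof.
move=> dN; set z := finv turn d; have zd : turn z = d := f_finv turn_inj d.
have zN : z \notin corners by rewrite -corner_turn zd.
case: (eqVneq z dq) => [zE|zq]; first by exists (inr B_qp); rewrite -zd zE.
case: (eqVneq z dp') => [zE|zp]; first by exists (inr B_pq'); rewrite -zd zE.
by exists (inl z); rewrite butterfly_turn_out // (negbTE zq) (negbTE zp) zd.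
Qed.

Lemma butterfly_turn_inj : injective (@turn H).
Proof.
have [tc tp' tq tq'] := butterfly_turn_corner.
have [pN qN q'N p'N] := end_out.
have [pf qs q's p'f] := end_facts.
have [_ q'p] := fst_snd_neq pf q's; have [_ qp'] := fst_snd_neq p'f qs.
apply: surjective_inj => -[d|[]].
- case: (boolP (d \in corners)) => [|dN].
    rewrite !inE => /or4P[] /eqP->.
    + by exists (inl cp').
    + by exists (inr B_uw).
    + by exists (inl cq).
    + by exists (inr B_wu).
  case: (eqVneq d dp) => [->|dp_]; first by exists (inr B_pq).
  case: (eqVneq d dq') => [->|dq_]; first by exists (inr B_qp').
  have [x xE] := butterfly_turn_before dN.
  by exists x; rewrite xE /before (negbTE dp_) (negbTE dq_).
- by exists (inl c).
- by exists (inl cq').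
- by have [x xE] := butterfly_turn_before pN; exists x; rewrite xE /before eqxx.
- by exists (inl dq); rewrite butterfly_turn_out // eqxx.
- by exists (inl dp'); rewrite butterfly_turn_out // eqxx eq_sym qp'.
- by have [x xE] := butterfly_turn_before q'N; exists x; rewrite xE /before eqxx q'p.
Qed.

Lemma butterfly_orgE d : d \notin corners -> org (inl d : H) = weaken (org d).
Proof.
rewrite !inE !negb_or => /and4P[/negbTE n1 /negbTE n2 /negbTE n3 /negbTE n4].
by rewrite /org /= n1 n2 n3 n4.
Qed.

Lemma butterfly_org_before d : d \notin corners -> org (before d) = weaken (org d).
Proof.
move=> dN; rewrite /before; case: eqP => [->|_] //.
by case: eqP => [->|_] //; apply: butterfly_orgE.
Qed.

Lemma butterfly_org_corner : [/\ org (inl c : H) = Some (inr None),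
  org (inl cp' : H) = Some (inr None), org (inl cq : H) = Some (inl None) &
  org (inl cq' : H) = Some (inl None)].
Proof.
have [_ _ [n1 n2 n3] [n4 n5 n6]] := corner_facts.
rewrite /org /= !eqxx ?orbT [cq == c]eq_sym [cq' == c]eq_sym.
by rewrite (negbTE n1) (negbTE n2) (negbTE n5) (negbTE n6) /= ?orbT.
Qed.

Lemma butterfly_org_turn (d : H) : org (turn d) = org d.
Proof.
have [tc tp' tq tq'] := butterfly_turn_corner.
have [oc op' oq oq'] := butterfly_org_corner.
have [pN qN q'N p'N] := end_out.
case: d => [d|[]].
- case: (boolP (d \in corners)) => [|dN].
    by rewrite !inE => /or4P[] /eqP->;
      rewrite ?tc ?tp' ?tq ?tq' ?oc ?op' ?oq ?oq'.
  rewrite butterfly_turn_out // butterfly_orgE //.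
  case: eqP => [->|_] //; case: eqP => [->|_] //.
  by rewrite butterfly_org_before ?corner_turn // (ed_org_turn ed).
- exact: op'.
- exact: oq.
- exact: butterfly_orgE.
- rewrite -[turn (inr B_qp : H)]/(before (turn dq)).
  by rewrite butterfly_org_before ?corner_turn // (ed_org_turn ed).
- rewrite -[turn (inr B_pq' : H)]/(before (turn dp')).
  by rewrite butterfly_org_before ?corner_turn // (ed_org_turn ed).
- exact: butterfly_orgE.
Qed.

Lemma butterfly_connect_before d : fconnect turn (before d) (inl d : H).
Proof.
rewrite /before; case: eqP => [->|_]; first exact: (fconnect1 (@turn H)).
by case: eqP => [->|_]; [apply: (fconnect1 (@turn H)) | apply: connect0].
Qed.

(** A turn at an old vertex survives, possibly with a detour through the darts of the new sides. *)
Lemma butterfly_connect_turn d : d \notin corners ->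
  fconnect turn (inl d : H) (inl (turn d)).
Proof.
move=> dN; apply: connect_trans (butterfly_connect_before _).
apply: connect_trans (fconnect1 (@turn H) _) _; rewrite butterfly_turn_out //.
case: eqP => [->|_]; first exact: (fconnect1 (@turn H)).
by case: eqP => [->|_]; [apply: (fconnect1 (@turn H)) | apply: connect0].
Qed.

(** A representative dart at the same vertex: one for w, one for u, and an old dart elsewhere. It
    reduces connectivity under the new [turn] to connectivity in [G]. *)
Definition base (d : H) : H :=
  match d with
  | inl d => if (d == c) || (d == cp') then inl c
             else if (d == cq) || (d == cq') then inl cq else inl d
  | inr B_wu => inl c
  | inr B_uw => inl cq
  | inr B_pq => inl dp
  | inr B_qp => inl dq
  | inr B_pq' => inl dp'
  | inr B_qp' => inl dq'
  end.

Lemma base_connect d : fconnect turn d (base d).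
Proof.
have [tc tp' tq tq'] := butterfly_turn_corner.
have [pN qN q'N p'N] := end_out.
have [pf qs q's p'f] := end_facts; have [_ qp'] := fst_snd_neq p'f qs.
have step (x y : H) : turn x = y -> fconnect turn x y by move=> <-; apply: fconnect1.
have sym := fconnect_sym butterfly_turn_inj.
case: d => [d|[]] /=; try exact: (step _ _ erefl).
- case: ifP => [/orP[]/eqP->|_]; [exact: connect0 | exact: step tp' |].
  by case: ifP => [/orP[]/eqP->|_]; [exact: connect0 | rewrite sym; exact: step tq |
    exact: connect0].
- by rewrite sym; apply: step.
- by rewrite sym; apply: step; rewrite butterfly_turn_out // eqxx.
- by rewrite sym; apply: step; rewrite butterfly_turn_out // eqxx eq_sym qp'.
Qed.

Lemma base_cases d : [\/ base d = inl c, base d = inl cq |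
  exists2 x, base d = inl x & x \notin corners].
Proof.
have [pN qN q'N p'N] := end_out.
case: d => [d|[]] /=; try by [constructor 1 | constructor 2 | constructor 3; eexists].
case: ifP => n1; first by constructor 1.
case: ifP => n2; first by constructor 2.
constructor 3; exists d => //; move: n1 n2; rewrite !inE.
by case: (d == c); case: (d == cq); case: (d == cq'); case: (d == cp').
Qed.

Lemma butterfly_org_connect (d d' : H) : ~~ is_crossing d -> org d = org d' ->
  fconnect turn d d'.
Proof.
have [oc op' oq oq'] := butterfly_org_corner.
have sym := fconnect_sym butterfly_turn_inj.
have org_base x : org (base x) = org x.
  rewrite -(iter_findex (base_connect x)); elim: findex => // n IH.
  by rewrite iterS butterfly_org_turn.
rewrite /is_crossing -(org_base d) -(org_base d') => dN dd'.
apply: connect_trans (base_connect d) _; rewrite sym.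
apply: connect_trans (base_connect d') _; rewrite sym.
move: dN dd'; case: (base_cases d) => [->|->|[x -> xN]];
  case: (base_cases d') => [->|->|[y -> yN]];
  rewrite ?oc ?oq ?butterfly_orgE //; try by case: org => [[]|].
move=> oxN oxy; have xy : fconnect turn x y.
  apply: (ed_org_connect ed); last exact: weaken_inj oxy.
  by move: oxN; rewrite /is_crossing; case: org => [[]|].
rewrite -(iter_findex xy); elim: findex => [|n IH]; first exact: connect0.
apply: connect_trans IH _; apply: butterfly_connect_turn.
by elim: n => //= n IH; rewrite corner_turn.
Qed.

Lemma butterfly_crossing d : d \notin corners -> is_crossing (inl d : H) = is_crossing d.
Proof. by move=> dN; rewrite /is_crossing butterfly_orgE //; case: org => [[]|]. Qed.

Lemma butterfly_crossing_out (d : H) : is_crossing d ->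
  exists x, [/\ d = inl x, x \notin corners & is_crossing x].
Proof.
have [oc op' oq oq'] := butterfly_org_corner.
have [pf qs q's p'f] := end_facts.
case: d => [d|[]]; last first.
- by move: (snd_not_crossing q's); rewrite /is_crossing /=; case: org => [[]|].
- by move: (fst_not_crossing p'f); rewrite /is_crossing /=; case: org => [[]|].
- by move: (snd_not_crossing qs); rewrite /is_crossing /=; case: org => [[]|].
- by move: (fst_not_crossing pf); rewrite /is_crossing /=; case: org => [[]|].
- by [].
- by [].
case: (boolP (d \in corners)) => [|dN].
  by rewrite !inE => /or4P[] /eqP->; rewrite /is_crossing ?oc ?op' ?oq ?oq'.
by rewrite butterfly_crossing // => dX; exists d.
Qed.

Lemma butterfly_turn_crossing d : d \notin corners -> is_crossing d ->
  turn (inl d : H) = inl (turn d).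
Proof.
move=> dN dX; have [pf qs q's p'f] := end_facts.
have tX : is_crossing (turn d) by rewrite /is_crossing (ed_org_turn ed).
have neq x y : is_crossing x -> ~~ is_crossing y -> (x == y) = false.
  by move=> xX yX; apply/eqP=> xy; rewrite -xy xX in yX.
by rewrite butterfly_turn_out // /before !neq //;
  first [exact: fst_not_crossing | exact: snd_not_crossing].
Qed.

Lemma butterfly_edges : exists e e', [/\ dp = e1 e, dq' = e2 e, dp' = e1 e',
  dq = e2 e' & e != e'].
Proof.
have [cX c4 [n1 n2 n3] _] := corner_facts; have [pf qs q's p'f] := end_facts.
have p'X : is_crossing cp' by apply: corner_crossing; rewrite !inE eqxx !orbT.
have s1 : on_strand dp (flip dq').
  by have := strand_ahead (strand_start dp); rewrite !flipK; apply.
have s2 : on_strand dp' (flip dq).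
  by have := strand_ahead (strand_start dp'); rewrite !flipK c4; apply.
have [e pE qE] := joined_edge ed pf q's s1.
have [e' pE' qE'] := joined_edge ed p'f qs s2.
exists e, e'; split=> //; apply: contraNneq n3 => ee'.
by apply/eqP; apply: flip_inj; rewrite pE pE' ee'.
Qed.

Section Edges.
Variables ep ep' : E.
Hypotheses (pE : dp = e1 ep) (qE' : dq' = e2 ep) (pE' : dp' = e1 ep')
  (qE : dq = e2 ep') (pp' : ep != ep').

(** The two crossing edges keep their indices and become pw and p'w. The first [bool] indexes uq and
    uq', the second the sides pq and p'q', with [true] for the primed one; the last index is uw. *)
Definition butterfly_fst (e : E + (bool + bool + 'I_1)) : H :=
  match e with
  | inl e => inl (e1 e)
  | inr (inl (inl b)) => inl (if b then cq' else cq)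
  | inr (inl (inr b)) => inr (if b then B_pq' else B_pq)
  | inr (inr _) => inr B_uw
  end.

Definition butterfly_snd (e : E + (bool + bool + 'I_1)) : H :=
  match e with
  | inl e => if e == ep then inl c else if e == ep' then inl cp' else inl (e2 e)
  | inr (inl (inl b)) => inl (if b then dq' else dq)
  | inr (inl (inr b)) => inr (if b then B_qp' else B_qp)
  | inr (inr _) => inr B_wu
  end.

(** A strand reaching the removed crossing point must have started at one of the four neighbouring
    ends, so it belongs to [ep] or [ep']. *)
Lemma butterfly_strand e : e != ep -> e != ep' ->
  on_strand (inl (e1 e) : H) (flip (inl (e2 e) : H)).
Proof.
move=> ne ne'; rewrite -[flip (inl _ : H)]/(inl (flip (e2 e)) : H).
have e1N : ~~ is_crossing (e1 e) by apply: fst_not_crossing; apply: (ed_is_fst ed).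
elim: (ed_strand ed e) => [|x ex IH xX]; first exact: strand_start.
have [pf qs q's p'f] := end_facts.
have xN : flip x \notin corners.
  have start d : ~~ is_crossing (flip d) -> flip x = d -> flip d = e1 e.
    move=> dN xd; apply: (on_strand_not_crossing ed _ dN).
    by rewrite -xd flipK.
  have := fst_not_snd (ed_is_fst ed e); rewrite !inE; apply: contraNN.
  case/or4P=> /eqP/start.
  - move/(_ (fst_not_crossing pf)); rewrite pE => /(ed_inj ed)/eqP.
    by rewrite eq_sym (negbTE ne).
  - by move/(_ (snd_not_crossing qs)) => <-.
  - by move/(_ (snd_not_crossing q's)) => <-.
  - move/(_ (fst_not_crossing p'f)); rewrite pE' => /(ed_inj ed)/eqP.
    by rewrite eq_sym (negbTE ne').
have -> : inl (turn (turn (flip x))) = turn (turn (flip (inl x : H))).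
  rewrite -[flip (inl x : H)]/(inl (flip x) : H) butterfly_turn_crossing //.
  by rewrite butterfly_turn_crossing ?corner_turn // /is_crossing (ed_org_turn ed).
by apply: strand_ahead => //; rewrite -[flip (inl x : H)]/(inl (flip x) : H) butterfly_crossing.
Qed.

Lemma butterfly_edge_drawing : edge_drawing butterfly_fst butterfly_snd.
Proof.
have [oc op' oq oq'] := butterfly_org_corner.
have [pf qs q's p'f] := end_facts.
have [pN qN q'N p'N] := end_out.
have fstE d : d \notin corners -> is_fst (inl d : H) = is_fst d.
  by move=> dN; rewrite /is_fst butterfly_orgE //; case: org => [[]|].
have sndE d : d \notin corners -> is_snd (inl d : H) = is_snd d.
  by move=> dN; rewrite /is_snd butterfly_orgE //; case: org => [[]|].
have wfst (d : G) : is_fst d -> (if weaken (org d) is Some (inl _) then true else false).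
  by rewrite /is_fst; case: org => [[]|].
have wsnd (d : G) : is_snd d -> (if weaken (org d) is Some (inr _) then true else false).
  by rewrite /is_snd; case: org => [[]|].
have e1N e : e1 e \notin corners.
  by apply: not_crossing_corner; apply: fst_not_crossing; apply: (ed_is_fst ed).
have e2N e : e2 e \notin corners.
  by apply: not_crossing_corner; apply: snd_not_crossing; apply: (ed_is_snd ed).
split.
- case=> [d|[]] //; by rewrite -[flip (flip _)]/(inl (flip (flip d)) : H) flipK.
- exact: butterfly_turn_inj.
- exact: butterfly_org_turn.
- exact: butterfly_org_connect.
- move=> d /butterfly_crossing_out[x [-> xN xX]].
  by rewrite !butterfly_turn_crossing ?corner_turn ?(ed_turn4 ed) // /is_crossing
    ?(ed_org_turn ed).
- move=> d /butterfly_crossing_out[x [-> xN xX]].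
  rewrite !butterfly_turn_crossing ?corner_turn //; last by rewrite /is_crossing (ed_org_turn ed).
  by apply: contraNneq (ed_turn2 ed xX) => -[xE]; apply/eqP.
- case=> [d|[]] //.
  + case: (boolP (d \in corners)) => [|dN].
      rewrite !inE => /or4P[] /eqP->; rewrite /is_fst ?oc ?op' //= => _.
        by exists (inr (inl (inl false))).
      by exists (inr (inl (inl true))).
    by rewrite fstE // => /(ed_fst ed)[e ->]; exists (inl e).
  + by move=> _; exists (inr (inr ord0)).
  + by move=> _; exists (inr (inl (inr false))).
  + by move: (wsnd _ qs); rewrite /is_fst /=; case: weaken => [[]|].
  + by move=> _; exists (inr (inl (inr true))).
  + by move: (wsnd _ q's); rewrite /is_fst /=; case: weaken => [[]|].
- case=> [d|[]] //.
  + case: (boolP (d \in corners)) => [|dN].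
      rewrite !inE => /or4P[] /eqP->; rewrite /is_snd ?oq ?oq' //= => _.
        by exists (inl ep); rewrite /= eqxx.
      by exists (inl ep'); rewrite /= eq_sym (negbTE pp') eqxx.
    rewrite sndE // => /(ed_snd ed)[e ->].
    case: (eqVneq e ep) => [->|ne]; first by exists (inr (inl (inl true))); rewrite /= qE'.
    case: (eqVneq e ep') => [->|ne']; first by exists (inr (inl (inl false))); rewrite /= qE.
    by exists (inl e); rewrite /= (negbTE ne) (negbTE ne').
  + by move=> _; exists (inr (inr ord0)).
  + by move: (wfst _ pf); rewrite /is_snd /=; case: weaken => [[]|].
  + by move=> _; exists (inr (inl (inr false))).
  + by move: (wfst _ p'f); rewrite /is_snd /=; case: weaken => [[]|].
  + by move=> _; exists (inr (inl (inr true))).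
- case=> [e|[[[]|[]]|x]] //=.
  + by rewrite fstE // (ed_is_fst ed).
  + by rewrite /is_fst oq'.
  + by rewrite /is_fst oq.
  + by rewrite /is_fst /= wfst.
  + by rewrite /is_fst /= wfst.
- case=> [e|[[[]|[]]|x]] //=.
  + case: ifP => _; first by rewrite /is_snd oc.
    case: ifP => _; first by rewrite /is_snd op'.
    by rewrite sndE // (ed_is_snd ed).
  + by rewrite sndE.
  + by rewrite sndE.
  + by rewrite /is_snd /= wsnd.
  + by rewrite /is_snd /= wsnd.
- have [_ _ [n1 n2 n3] [n4 n5 n6]] := corner_facts.
  have no e b : (e1 e == if b then cq' else cq) = false.
    apply/eqP=> eE; move: (e1N e); rewrite eE.
    by case: b {eE}; rewrite !inE eqxx ?orbT.
  case=> [e|[[b|b]|x]] [e'|[[b'|b']|x']] //=.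
  + by case=> /(ed_inj ed) ->.
  + by case=> /eqP; rewrite no.
  + by case=> /esym/eqP; rewrite no.
  + by case: b b' => [] [] // [] /turn_inj /eqP; rewrite ?(negbTE n1) // eq_sym (negbTE n1).
  + by case: b b' => [] [].
  + by case: b.
  + by case: b'.
  + by rewrite (ord1 x) (ord1 x').
- case=> [e|[[b|b]|x]] /=; last exact: strand_start.
  + case: eqP => [->|/eqP ne].
      by rewrite /flip /= -pE; apply: strand_start.
    case: eqP => [->|/eqP ne']; last exact: butterfly_strand.
    by rewrite /flip /= -pE'; apply: strand_start.
  + have -> : inl (if b then cq' else cq) = flip (butterfly_snd (inr (inl (inl b)))).
      by case: b; congr inl; rewrite flipK.
    exact: strand_start.
  + by case: b; apply: strand_start.
Qed.

Lemma butterfly_adjacency :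
  let M := drawn_adjacency butterfly_fst butterfly_snd in
  M None None = -1 /\ forall v y,
  M (Some v) (Some y) + M (Some v) None * M None (Some y) = drawn_adjacency e1 e2 v y.
Proof.
move=> M; have [pf qs q's p'f] := end_facts.
have [pN qN q'N p'N] := end_out.
have [_ _ [n1 n2 n3] [n4 n5 n6]] := corner_facts.
have [oc op' oq oq'] := butterfly_org_corner.
have e1N e : e1 e \notin corners.
  by apply: not_crossing_corner; apply: fst_not_crossing; apply: (ed_is_fst ed).
have e2N e : e2 e \notin corners.
  by apply: not_crossing_corner; apply: snd_not_crossing; apply: (ed_is_snd ed).
have inlN (A B : eqType) (o : option A) :
  (Some (inl None) == Some (inl o) :> option (option A + B)) = (o == None) by case: o.
have inrN (A B : eqType) (o : option B) :
  (Some (inr None) == Some (inr o) :> option (A + option B)) = (o == None) by case: o.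
pose a := if sw then wt dp' else wt dp; pose b := if sw then wt dp else wt dp'.
pose P v := weaken (org dp) == Some (inl v); pose P' v := weaken (org dp') == Some (inl v).
pose Q y := weaken (org dq) == Some (inr y); pose Q' y := weaken (org dq') == Some (inr y).
pose rest v y := \sum_(e | (e != ep) && (e != ep'))
      if (weaken (org (e1 e)) == Some (inl v)) && (weaken (org (e2 e)) == Some (inr y))
      then wt (e1 e) else 0.
have wt_p : wt (inl dp : H) = if sw then - b else 1 by rewrite /wt /= eqxx.
have pp'N : (dp' == dp) = false by rewrite (inj_eq flip_inj) eq_sym (negbTE n3).
have wt_p' : wt (inl dp' : H) = if sw then 1 else - b by rewrite /wt /= pp'N eqxx.
have not_dp x : x \in corners -> (x == dp) = false /\ (x == dp') = false.
  by move=> xc; split; apply/eqP=> xE; [move: pN | move: p'N]; rewrite -xE xc.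
have [cq_p cq_p'] : (cq == dp) = false /\ (cq == dp') = false.
  by apply: not_dp; rewrite !inE eqxx orbT.
have [cq'_p cq'_p'] : (cq' == dp) = false /\ (cq' == dp') = false.
  by apply: not_dp; rewrite !inE eqxx !orbT.
have wt_q : wt (inl cq : H) = if sw then a else -1.
  by rewrite /wt /= cq_p cq_p' eqxx.
have wt_q' : wt (inl cq' : H) = if sw then -1 else a.
  by rewrite /wt /= cq'_p cq'_p' [cq' == cq]eq_sym (negbTE n4) eqxx.
have wt_e e : e != ep -> e != ep' -> wt (inl (e1 e) : H) = wt (e1 e).
  move=> ne ne'; rewrite /wt /= pE pE' !(inj_eq (ed_inj ed)) (negbTE ne) (negbTE ne').
  have := e1N e; rewrite !inE !negb_or => /and4P[_ /negbTE -> /negbTE -> _].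
  by [].
have ME v y : M v y = (if P v && (y == None) then (if sw then - b else 1) else 0)
  + ((if P' v && (y == None) then (if sw then 1 else - b) else 0) + rest v y)
  + ((if (v == None) && Q' y then (if sw then -1 else a) else 0)
     + (if (v == None) && Q y then (if sw then a else -1) else 0)
     + ((if P' v && Q' y then (if sw then 1 else a * b) else 0)
     + (if P v && Q y then (if sw then a * b else 1) else 0))
     + (if (v == None) && (y == None) then -1 else 0)).
  rewrite /M /drawn_adjacency big_mkcond !big_sumType !big_bool big_ord1.
  rewrite (bigD1 ep) // (bigD1 ep'); last by rewrite eq_sym pp'.
  have f_e e : org (butterfly_fst (inl e)) = weaken (org (e1 e)) by apply: butterfly_orgE.
  have s_p : org (butterfly_snd (inl ep)) = Some (inr None) by rewrite /butterfly_snd eqxx.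
  have s_p' : org (butterfly_snd (inl ep')) = Some (inr None).
    by rewrite /butterfly_snd eq_sym (negbTE pp') eqxx.
  have s_e e : e != ep -> e != ep' -> org (butterfly_snd (inl e)) = weaken (org (e2 e)).
    by move=> ne ne'; rewrite /butterfly_snd (negbTE ne) (negbTE ne') butterfly_orgE.
  have f_spoke i : org (butterfly_fst (inr (inl (inl i)))) = Some (inl None).
    by case: i.
  have s_spoke i : org (butterfly_snd (inr (inl (inl i)))) = weaken (org (if i then dq' else dq)).
    by case: i; apply: butterfly_orgE.
  have f_side i : org (butterfly_fst (inr (inl (inr i)))) = weaken (org (if i then dp' else dp)).
    by case: i.
  have s_side i : org (butterfly_snd (inr (inl (inr i)))) = weaken (org (if i then dq' else dq)).
    by case: i.
  have f_mid i : org (butterfly_fst (inr (inr i))) = Some (inl None) by [].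
  have s_mid i : org (butterfly_snd (inr (inr i))) = Some (inr None) by [].
  have w_p : wt (butterfly_fst (inl ep)) = if sw then - b else 1 by rewrite /butterfly_fst -pE.
  have w_p' : wt (butterfly_fst (inl ep')) = if sw then 1 else - b by rewrite /butterfly_fst -pE'.
  rewrite !f_e s_p s_p' !f_spoke !s_spoke !f_side !s_side f_mid s_mid w_p w_p' !inlN !inrN.
  rewrite -pE -pE' [wt (butterfly_fst (inr (inl (inl true))))]wt_q'.
  rewrite [wt (butterfly_fst (inr (inl (inl false))))]wt_q; congr (_ + (_ + _) + _).
  by apply: eq_bigr => e /andP[ne ne']; rewrite f_e s_e // wt_e.
have rest0l y : rest None y = 0.
  by apply: big1 => e _; rewrite (weaken_None _).1.
have rest0r v : rest v None = 0.
  by apply: big1 => e _; rewrite (weaken_None _).2 andbF.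
have P0 : P None = false /\ P' None = false by rewrite /P /P' !(weaken_None _).1.
have Q0 : Q None = false /\ Q' None = false by rewrite /Q /Q' !(weaken_None _).2.
split; first by rewrite ME rest0l P0.1 P0.2 Q0.1 Q0.2 /= !add0r.
move=> v y; rewrite !ME rest0l rest0r P0.1 P0.2 Q0.1 Q0.2 /= !andbF !andbT.
have -> : drawn_adjacency e1 e2 v y = (if P (Some v) && Q' (Some y) then wt dp else 0)
    + ((if P' (Some v) && Q (Some y) then wt dp' else 0) + rest (Some v) (Some y)).
  rewrite /drawn_adjacency big_mkcond (bigD1 ep) // (bigD1 ep') /=; last by rewrite eq_sym pp'.
  rewrite -pE -pE' -qE -qE' /P /P' /Q /Q' !weaken_inl !weaken_inr; congr (_ + (_ + _)).
  by apply: eq_bigr => e _; rewrite !weaken_inl !weaken_inr.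
(* The products through u and w cancel the sides pq and p'q' and restore [wt dp] at (p, q') and
   [wt dp'] at (p', q). The case split also covers coinciding vertices. *)
rewrite /a /b; case: (P _); case: (P' _); case: (Q _); case: (Q' _); case: sw => /=; ring.
Qed.

End Edges.

Lemma butterfly_preserves z : is_det (drawn_adjacency e1 e2) z ->
  exists (E' : finType) (e1' e2' : E' -> H),
    edge_drawing e1' e2' /\ is_det (drawn_adjacency e1' e2') (- z).
Proof.
move=> Gz; have [e [e' [pE qE' pE' qE ee']]] := butterfly_edges.
exists (E + (bool + bool + 'I_1))%type, butterfly_fst, (butterfly_snd e e').
split; first exact: butterfly_edge_drawing.
have [M00 Ms] := butterfly_adjacency pE qE' pE' qE ee'.
by apply: is_det_schur => //; apply: is_det_eq Gz => v y; apply: Ms.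
Qed.

End Butterflies.

(** The invariant of both kinds of moves. Allowing a sign avoids counting the moves and fixing
    enumerations of the vertices. *)
Definition has_det (K : comNzRingType) (G : drawing K) (z : K) : Prop :=
  exists (E : finType) (e1 e2 : E -> G) (z' : K),
    [/\ edge_drawing e1 e2, is_det (drawn_adjacency e1 e2) z' & up_to_sign z' z].

Lemma up_to_signN (K : pzRingType) (x y : K) : up_to_sign x y -> up_to_sign (- x) y.
Proof. by move=> [b ->]; exists (~~ b); rewrite signrN mulNr. Qed.

Lemma triplings_has_det (K : comNzRingType) (G H : drawing K) (z : K) :
  triplings G H -> has_det G z -> has_det H z.
Proof.
move=> GH Gz; elim: GH => // {}H s1 s2 dv _ [E [e1 [e2 [z' [ed Mz z'z]]]]] s_ok.
have [E' [e1' [e2' [ed' Mz']]]] := triple_preserves ed s_ok Mz.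
by exists E', e1', e2', (- z'); split=> //; apply: up_to_signN.
Qed.

Lemma butterflies_has_det (K : comNzRingType) (G H : drawing K) (z : K) :
  butterflies G H -> has_det G z -> has_det H z.
Proof.
move=> GH Gz; elim: GH => // {}H c sw _ [E [e1 [e2 [z' [ed Mz z'z]]]]] c_ok.
have [E' [e1' [e2' [ed' Mz']]]] := butterfly_preserves ed sw c_ok Mz.
by exists E', e1', e2', (- z'); split=> //; apply: up_to_signN.
Qed.

Theorem theorem4p7 (R : idomainType) (n : nat) (n_gt0 : (0 < n)%N)
    (D : knot_diagram) (a0 : face D)
    (rho : word a0 -> 'M[R]_n) (rho_rep : representation rho)
    (psi : word a0 -> int) (psi_ab : abelianization psi)
    (k : nat) (cr : 'I_k -> crossing D) (cr_bij : bijective cr)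
    (fc : 'I_k.+1 -> gen a0) (fc_bij : bijective fc)
    (j0 : 'I_k.+1) (a1_adjacent : adjacent a0 (val (fc j0)))
    (G1 G2 G3 : drawing {fraction {poly R}})
    (step2 : minimal_drawing (twisted_graph (val (fc j0)) rho) G1)
    (step3 : triplings G1 G2) (step3_done : crossed_once G2)
    (step4 : butterflies G2 G3) (step4_done : uncrossed G3)
    (eps : G3 -> bool) (step5 : spanning_tree_weighting eps) :
  doteq (partition_function eps) (twisted_alexander rho psi cr fc j0).
Proof.
have [z Gz z_alexander] := twisted_alexander_is_det rho_rep psi_ab cr_bij fc_bij j0.
have [E1 [e1 [e2 [ed1 Mz]]]] := draws_edge_drawing step2.1 Gz.
have G1_det : has_det G1 z by exists E1, e1, e2, z; split=> //; exists false; rewrite mul1r.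
have [E [d1 [d2 [z' [ed [N [f [g [f_bij g_bij z'E]]]] z'z]]]]] :=
  butterflies_has_det step4 (triplings_has_det step3 G1_det).
have [G3_bip adjE] := uncrossed_bipartite_map ed step4_done.
have [eps_flip eps_signed] := step5.
have [b bE] := partition_function_det G3_bip eps_flip f_bij g_bij eps_signed.
have [b' ->] : up_to_sign (partition_function eps) (twisted_alexander rho psi cr fc j0).
  apply: up_to_sign_trans z_alexander; apply: up_to_sign_trans z'z.
  exists b; rewrite bE z'E; congr (_ * \det _).
  by apply/matrixP=> i j; rewrite !mxE adjE.
(* The power of t is trivial, as the Fox matrix and the adjacency matrix differ by signs only. *)
by exists b', 0; rewrite expr0z mulr1.
Qed.
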